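(* Let $d\in\mathbb{N}$ and let $\tau\ge d+1$ be given. For $n\in\mathbb{N}$ and $\boldsymbol{p}\in\mathscr{P}_\tau$, let $\boldsymbol{K}\sim\mathrm{Multinomial}(n,\boldsymbol{p})$ and $\boldsymbol{U}\sim\mathrm{Uniform}(-1/2,1/2)^d$ be independent, define $\boldsymbol{X}:=\boldsymbol{K}+\boldsymbol{U}$, and let $\widetilde{\mathbb{P}}_{n,\boldsymbol{p}}$ be the law of $\boldsymbol{X}$. Let $\mathbb{Q}_{n,\boldsymbol{p}}$ be the law of the multivariate normal distribution $\mathrm{Normal}_d(n\boldsymbol{p},n\Sigma_{\boldsymbol{p}})$. Then, for all $n\ge\tau^4$, $$\sup_{\boldsymbol{p}\in\mathscr{P}_\tau}\|\widetilde{\mathbb{P}}_{n,\boldsymbol{p}}-\mathbb{Q}_{n,\boldsymbol{p}}\|\le\frac{8.03\,\tau^{3/2}(d+1)^{1/2}}{n^{1/2}},$$ where $\|\cdot\|$ denotes the total variation norm.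
   Context: $\mathcal{S}_d=\{\boldsymbol{s}\in[0,1]^d:\sum_{i=1}^d s_i\le1\}$, $\mathcal{S}_d^o=\{\boldsymbol{s}\in(0,1)^d:\sum_{i=1}^d s_i<1\}$, and $s_{d+1}:=1-\sum_{i=1}^d s_i$ for $\boldsymbol{s}\in\mathcal{S}_d$. $\mathscr{P}_\tau:=\{\boldsymbol{s}\in\mathcal{S}_d^o:\max_{1\le i\le d+1}s_i^{-1}\le\tau\}$. $\mathrm{Multinomial}(n,\boldsymbol{p})$ is the distribution on $\mathbb{N}_0^d\cap n\mathcal{S}_d$ (first $d$ of $d+1$ category counts) with mass function $P_{n,\boldsymbol{p}}(\boldsymbol{k})=\frac{n!}{\prod_{i=1}^{d+1}k_i!}\prod_{i=1}^{d+1}p_i^{k_i}$, where $k_{d+1}:=n-\sum_{i=1}^dk_i$ and $p_{d+1}:=1-\sum_{i=1}^dp_i$. $\Sigma_{\boldsymbol{p}}:=\mathrm{diag}(\boldsymbol{p})-\boldsymbol{p}\boldsymbol{p}^\top$. For probability measures $\mu,\nu$ on $\mathbb{R}^d$, $\|\mu-\nu\|=\sup_{A}|\mu(A)-\nu(A)|$, the supremum being over Borel sets $A\subseteq\mathbb{R}^d$. *)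

(* Defs.v *)
From HB Require Import structures.
From mathcomp Require Import all_boot all_order all_algebra.
From mathcomp Require Import all_classical all_reals all_analysis.
From mathcomp Require Import measurable_realfun ring lra.
Set Implicit Arguments.
Unset Strict Implicit.
Unset Printing Implicit Defensive.
Import Order.TTheory GRing.Theory Num.Theory.
Import numFieldNormedType.Exports.
Local Open Scope classical_set_scope.
Local Open Scope ring_scope.

Section simplex.
Context {R : realType} {d : nat}.
Implicit Types s : 'rV[R]_d.

Definition simplex : set 'rV[R]_d :=
  [set s | (forall i, 0 <= s 0 i <= 1) /\ \sum_i s 0 i <= 1].

Definition open_simplex : set 'rV[R]_d :=
  [set s | (forall i, 0 < s 0 i < 1) /\ \sum_i s 0 i < 1].

(* (s_1, ..., s_d, s_(d+1)) with s_(d+1) := 1 - \sum_i s_i *)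
Definition all_probs s : 'I_d.+1 -> R := fun i =>
  if unlift ord_max i is Some j then s 0 j else 1 - \sum_j s 0 j.

Definition simplex_le (tau : R) : set 'rV[R]_d :=
  [set s | open_simplex s /\
           \big[Num.max/0]_(i < d.+1) (all_probs s i)^-1 <= tau].

End simplex.

(* On n.-tuple T the library's sigma-algebra is the product one, hence the
   Borel sigma-algebra when T is the real line. *)
Section power_measure.
Context {dT : measure_display} {T : measurableType dT} {R : realType}.

Definition tcons n (xt : T * n.-tuple T) : n.+1.-tuple T :=
  [tuple of xt.1 :: xt.2].

Fixpoint power_measure (mu : set T -> \bar R) (n : nat) :
    set (n.-tuple T) -> \bar R :=
  match n with
  | 0%N => \d_([tuple] : 0.-tuple T)
  | n'.+1 => pushforward (mu \x @power_measure mu n')%E (@tcons n')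
  end.

Lemma measurable_tcons n : measurable_fun [set: T * n.-tuple T] (@tcons n).
Proof. exact: measurable_cons. Qed.

Let tuncons n (t : n.+1.-tuple T) : T * n.-tuple T :=
  (thead t, [tuple of behead t]).

Let tconsK n : cancel (@tcons n) (@tuncons n).
Proof.
by move=> [x t]; congr pair; apply/val_inj.
Qed.

Let tunconsK n : cancel (@tuncons n) (@tcons n).
Proof. by move=> t; rewrite /tcons/= -tuple_eta. Qed.

Let measurable_tuncons n : measurable_fun [set: n.+1.-tuple T] (@tuncons n).
Proof.
apply/measurable_fun_pair; first exact: measurable_tnth.
exact: measurable_behead.
Qed.

Let sigma_finite_product (mu : {sigma_finite_measure set T -> \bar R}) n
    (nu : {sigma_finite_measure set (n.-tuple T) -> \bar R}) :
  sigma_finite setT (mu \x nu)%E.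
Proof.
have /sigma_finiteP[F [TF ndF Foo]] := sigma_finiteT mu.
have /sigma_finiteP[G [TG ndG Goo]] := sigma_finiteT nu.
exists (fun k => F k `*` G k).
  rewrite -setXTT TF TG predeqE => -[x y]; split; last first.
    by move=> [k _ []/= ? ?]; split; exists k.
  move=> [/= [j _ Fjx] [k _ Gky]]; exists (maxn j k) => //; split.
  - by move: x Fjx; exact/subsetPset/ndF/leq_maxl.
  - by move: y Gky; exact/subsetPset/ndG/leq_maxr.
move=> k; have [? ?] := Foo k; have [? ?] := Goo k.
split; first exact: measurableX.
by rewrite product_measure1E// lte_mul_pinfty// ge0_fin_numE.
Qed.

Let sigma_finite_tcons n (m : {measure set (T * n.-tuple T)%type -> \bar R}) :
  sigma_finite setT m -> exists nu : {sigma_finite_measure set (n.+1.-tuple T) -> \bar R},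
    pushforward m (@tcons n) = nu :> (set _ -> \bar R).
Proof.
move=> [F FT Ffin]; pose nu0 := pushforward m (@tcons n).
have sf : sigma_finite setT nu0.
  exists (fun i => @tuncons n @^-1` F i).
    by rewrite -preimage_bigcup -FT preimage_setT.
  move=> i; have [mF Foo] := Ffin i; split.
    by rewrite -[X in measurable X]setTI; exact: measurable_tuncons.
  rewrite /nu0 /pushforward -comp_preimage.
  by rewrite (_ : _ \o _ = id) //; apply/funext => x /=; exact: tconsK.
pose M := @Measure_isSigmaFinite.Build _ _ R nu0 sf.
pose nu : {sigma_finite_measure set (n.+1.-tuple T) -> \bar R} :=
  HB.pack nu0 (M (@measurable_tcons n)).
by exists (nu (@measurable_tcons n)).
Qed.

Lemma power_measure_sigma_finite
    (mu : {sigma_finite_measure set T -> \bar R}) n :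
  exists nu : {sigma_finite_measure set (n.-tuple T) -> \bar R},
    @power_measure mu n = nu :> (set _ -> \bar R).
Proof.
elim: n => [|n [nu IH]] /=; first by exists \d_([tuple] : 0.-tuple T).
by rewrite IH; exact/sigma_finite_tcons/sigma_finite_product.
Qed.

Section instances.
Variables (mu : {sigma_finite_measure set T -> \bar R}) (n : nat).
Local Notation pm := (@power_measure mu n).

Let pm0 : pm set0 = 0%E.
Proof. by have [nu ->] := power_measure_sigma_finite mu n; exact: measure0. Qed.

Let pm_ge0 A : (0 <= pm A)%E.
Proof.
by have [nu ->] := power_measure_sigma_finite mu n; exact: measure_ge0.
Qed.

Let pm_sigma_additive : semi_sigma_additive pm.
Proof.
have [nu ->] := power_measure_sigma_finite mu n.
exact: measure_semi_sigma_additive.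
Qed.

HB.instance Definition _ := isMeasure.Build _ _ _ pm
  pm0 pm_ge0 pm_sigma_additive.

Let pm_sigma_finite : sigma_finite setT pm.
Proof.
by have [nu ->] := power_measure_sigma_finite mu n; exact: sigma_finiteT.
Qed.

HB.instance Definition _ := @Measure_isSigmaFinite.Build _ _ _ pm
  pm_sigma_finite.

End instances.

Section probability.
Variables (mu : probability T R).

Let pm_setT n : @power_measure mu n setT = 1%E.
Proof.
elim: n => [|n IH]; first by rewrite /= diracT.
rewrite /= /pushforward preimage_setT -setXTT.
by rewrite product_measure1E //= IH probability_setT mule1.
Qed.

HB.instance Definition _ n := @Measure_isProbability.Build _ _ _
  (@power_measure mu n) (@pm_setT n).
End probability.

End power_measure.
Arguments power_measure {dT T R} mu n.


Section multinomial.
Context {R : realType} {d : nat}.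
Implicit Types (n : nat) (p : 'rV[R]_d) (k : d.-tuple nat).

(* (k_1, ..., k_d, k_(d+1)) with k_(d+1) := n - \sum_i k_i *)
Definition all_counts n k : 'I_d.+1 -> nat := fun i =>
  if unlift ord_max i is Some j then tnth k j
  else (n - \sum_(j < d) tnth k j)%N.

Definition multinomial_pmf n p k : R :=
  if (\sum_(j < d) tnth k j <= n)%N then
    n`!%:R / \prod_(i < d.+1) (all_counts n k i)`!%:R *
    \prod_(i < d.+1) all_probs p i ^+ all_counts n k i
  else 0.

(* the value is a dummy probability measure when p is not in the simplex *)
Definition multinomial_prob n p : set (d.-tuple nat) -> \bar R := fun A =>
  if p \in simplex then \esum_(k in A) (multinomial_pmf n p k)%:E
  else \d_([tuple of nseq d 0%N] : d.-tuple nat) A.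

End multinomial.

Section multinomial_theorem.
Context {R : realType}.
Implicit Types (n : nat) (q : R).
Local Open Scope ereal_scope.

Let term d n (p : 'I_d -> R) q (k : d.-tuple nat) : R :=
  (if (\sum_(j < d) tnth k j <= n)%N then
    n`!%:R / ((\prod_(j < d) (tnth k j)`!%:R) * (n - \sum_(j < d) tnth k j)`!%:R)
    * ((\prod_(j < d) p j ^+ tnth k j) * q ^+ (n - \sum_(j < d) tnth k j))
  else 0)%R.

Let term_ge0 d n (p : 'I_d -> R) q k :
  (forall i, 0 <= p i)%R -> (0 <= q)%R -> (0 <= term n p q k)%R.
Proof.
move=> p0 q0; rewrite /term; case: ifP => // _.
apply: mulr_ge0; first by apply: divr_ge0 => //; rewrite mulr_ge0// prodr_ge0.
by rewrite mulr_ge0 ?exprn_ge0// prodr_ge0// => i _; rewrite exprn_ge0.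
Qed.

Let term_tcons d n (p : 'I_d.+1 -> R) q (x : nat) (t : d.-tuple nat) :
  term n p q (tcons (x, t)) =
  (if (x <= n)%N then 'C(n, x)%:R * p ord0 ^+ x *
     term (n - x) (fun i => p (lift ord0 i)) q t else 0)%R.
Proof.
have sE : (\sum_(j < d.+1) tnth (tcons (x, t)) j =
    x + \sum_(j < d) tnth t j)%N.
  rewrite big_ord_recl; congr addn; apply: eq_bigr => i _.
  by rewrite /tcons tnthS.
rewrite /term sE; set s := (\sum_(j < d) _)%N.
have [xn|nx] := leqP x n; last by rewrite ifF// leqNgt ltn_addr.
rewrite leq_subRL// subnDA; case: ifP => _; last by rewrite mulr0.
rewrite !big_ord_recl /=.
have -> : (\prod_(i < d) (tnth (tcons (x, t)) (lift ord0 i))`!%:R =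
    \prod_(i < d) (tnth t i)`!%:R :> R)%R.
  by apply: eq_bigr => i _; rewrite /tcons tnthS.
have -> : (\prod_(i < d) p (lift ord0 i) ^+ tnth (tcons (x, t)) (lift ord0 i) =
    \prod_(i < d) p (lift ord0 i) ^+ tnth t i :> R)%R.
  by apply: eq_bigr => i _; rewrite /tcons tnthS.
have -> : tnth (tcons (x, t)) ord0 = x by [].
rewrite -(bin_fact xn) !natrM.
have fx m : (m`!%:R != 0 :> R)%R by rewrite pnatr_eq0 -lt0n fact_gt0.
have pf : (\prod_(i < d) (tnth t i)`!%:R != 0 :> R)%R.
  by apply/prodf_neq0 => i _.
field.
by rewrite !fx pf.
Qed.

Let esumZl (T : choiceType) (a : T -> \bar R) (c : R) :
  (0 <= c)%R -> (forall i, 0 <= a i) ->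
  \esum_(i in [set: T]) (c%:E * a i) = c%:E * \esum_(i in [set: T]) a i.
Proof.
move=> c0 a0; rewrite /esum -ereal_supZl//; last first.
  by apply/set0P; exists (\sum_(i \in set0) a i); exists set0 => //; exact: fsets_set0.
congr ereal_sup; rewrite image_comp; apply: eq_imagel => A _ /=.
by rewrite ge0_mule_fsumr.
Qed.

Let multinomial_theorem d n (p : 'I_d -> R) q :
  (forall i, 0 <= p i)%R -> (0 <= q)%R ->
  \esum_(k in [set: d.-tuple nat]) (term n p q k)%:E =
  ((\sum_i p i + q) ^+ n)%:E.
Proof.
elim: d n p => [|d IH] n p p0 q0.
  have -> : [set: 0.-tuple nat] = [set [tuple]].
    by apply/seteqP; split => // t _; rewrite /= tuple0.
  rewrite esum_set1; last by rewrite lee_fin term_ge0.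
  rewrite /term !big_ord0 /= subn0 add0r !mul1r divff ?mul1r//.
rewrite (@reindex_esum _ _ _ ([set: nat] `*`` fun=> [set: d.-tuple nat]) _
  (@tcons _ _ d)); last first.
  split => //; first by move=> [x t] [y u] _ _ /(congr1 val)/= [-> /val_inj ->].
  by move=> t _; exists (thead t, [tuple of behead t]) => //=; rewrite /tcons/= -tuple_eta.
transitivity (\esum_(x in [set: nat]) \esum_(t in [set: d.-tuple nat])
    (term n p q (tcons (x, t)))%:E).
  rewrite esum_esum; last by move=> x t _ _; rewrite lee_fin term_ge0.
  by apply: eq_esum => -[x t] _.
pose s := (\sum_i p (lift ord0 i) + q)%R.
have s0 : (0 <= s)%R by rewrite addr_ge0// sumr_ge0.
transitivity (\esum_(x in [set: nat]) (if (x <= n)%N then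
    'C(n, x)%:R * p ord0 ^+ x * s ^+ (n - x) else 0)%R%:E).
  apply: eq_esum => x _.
  under eq_esum do rewrite term_tcons.
  case: ifP => xn; last by rewrite esum1.
  under eq_esum do rewrite EFinM.
  rewrite esumZl; last 2 first.
  - by rewrite mulr_ge0// exprn_ge0.
  - by move=> t; rewrite lee_fin term_ge0.
  by rewrite IH.
rewrite (esumID `I_n.+1); last first.
  by move=> x _; case: ifP => // _; rewrite lee_fin !mulr_ge0// exprn_ge0.
rewrite [X in _ + X]esum1 ?adde0; last first.
  by move=> /= x [_ /negP]; rewrite -leqNgt ltnNge => /negbTE ->.
rewrite setTI esum_fset//; last first.
  by move=> x _; case: ifP => // _; rewrite lee_fin !mulr_ge0// exprn_ge0.
rewrite -fsbig_ord//= sumEFin; congr EFin.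
have -> : (\sum_i p i + q = s + p ord0)%R by rewrite big_ord_recl -addrA addrC.
rewrite exprDn; apply: eq_bigr => i _.
by rewrite -ltnS ltn_ord -mulrA mulr_natl mulrC.
Qed.

Let all_term d n (p : 'rV[R]_d) (k : d.-tuple nat) :
  multinomial_pmf n p k = term n (p 0%R) (1 - \sum_j p 0 j)%R k.
Proof.
have wE (i : 'I_d) : unlift ord_max (widen_ord (leqnSn d) i) = Some i.
  rewrite (_ : widen_ord _ _ = lift ord_max i) ?liftK//.
  by apply/val_inj; rewrite /= /bump leqNgt ltn_ord.
rewrite /multinomial_pmf /term; case: ifP => // _.
rewrite !big_ord_recr /= /all_counts /all_probs unlift_none.
do ![under eq_bigr do rewrite wE].
by congr (_ / (_ * _) * (_ * _))%R; apply: eq_bigr => i _; rewrite wE.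
Qed.

Lemma multinomial_pmf_ge0 d n (p : 'rV[R]_d) k :
  simplex p -> (0 <= multinomial_pmf n p k)%R.
Proof.
move=> [p01 sp]; rewrite all_term term_ge0 ?subr_ge0// => i.
by have /andP[] := p01 i.
Qed.

Lemma multinomial_pmf_sum1 d n (p : 'rV[R]_d) : simplex p ->
  \esum_(k in [set: d.-tuple nat]) (multinomial_pmf n p k)%:E = 1.
Proof.
move=> [p01 sp]; under eq_esum do rewrite all_term.
rewrite multinomial_theorem ?subr_ge0//; last by move=> i; have /andP[] := p01 i.
by rewrite addrC subrK expr1n.
Qed.

End multinomial_theorem.

Section multinomial_probability.
Context {R : realType} {d : nat}.
Variables (n : nat) (p : 'rV[R]_d).
Local Open Scope ereal_scope.
Local Notation multinomial := (multinomial_prob n p).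

Let multinomial0 : multinomial set0 = 0.
Proof.
by rewrite /multinomial_prob; case: ifPn => _; rewrite ?measure0 ?esum_set0.
Qed.

Let multinomial_ge0 A : 0 <= multinomial A.
Proof.
rewrite /multinomial_prob; case: ifPn => // /set_mem p01.
by apply: esum_ge0 => k _; rewrite lee_fin multinomial_pmf_ge0.
Qed.

Let multinomial_sigma_additive : semi_sigma_additive multinomial.
Proof.
move=> F mF tF mUF; rewrite /multinomial_prob; case: ifPn => [/set_mem p01|_].
  apply: cvg_toP.
    apply: ereal_nondecreasing_is_cvgn => a b ab.
    apply: lee_sum_nneg_natr => // k _ _.
    by apply: esum_ge0 => ? _; rewrite lee_fin multinomial_pmf_ge0.
  by rewrite nneseries_sum_bigcup// => k; rewrite lee_fin multinomial_pmf_ge0.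
exact: measure_semi_sigma_additive.
Qed.

HB.instance Definition _ := isMeasure.Build _ _ _ multinomial
  multinomial0 multinomial_ge0 multinomial_sigma_additive.

Let multinomial_setT : multinomial [set: _] = 1.
Proof.
rewrite /multinomial_prob; case: ifPn => [/set_mem p01|_].
  exact: multinomial_pmf_sum1.
exact: probability_setT.
Qed.

HB.instance Definition _ :=
  @Measure_isProbability.Build _ _ R multinomial multinomial_setT.

End multinomial_probability.

Notation Rn R d := (d.-tuple (measurableTypeR R)).

Section jittered_multinomial.
Context {R : realType} {d : nat}.

Lemma half_interval : - 2^-1 < 2^-1 :> R.
Proof. by lra. Qed.

Definition uniform_cube : set (Rn R d) -> \bar R :=
  power_measure (uniform_prob half_interval) d.

HB.instance Definition _ := Probability.on uniform_cube.

Definition jitter (ku : d.-tuple nat * Rn R d) : Rn R d :=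
  [tuple (tnth ku.1 i)%:R + tnth ku.2 i : R | i < d].

Let measurable_jitter : measurable_fun setT jitter.
Proof.
apply/measurable_fun_tnthP => i.
rewrite (_ : _ \o _ = fun ku => (tnth ku.1 i)%:R + tnth ku.2 i : R); last first.
  by apply/funext => ku /=; rewrite tnth_mktuple.
apply: measurable_funD.
  apply: (@measurableT_comp _ _ _ _ _ _ (fun m : nat => m%:R : R)) => //.
  by apply: (measurableT_comp (@measurable_tnth _ _ _ i)); exact: measurable_fst.
by apply: (measurableT_comp (@measurable_tnth _ _ _ i)); exact: measurable_snd.
Qed.

HB.instance Definition _ :=
  @isMeasurableFun.Build _ _ _ _ jitter measurable_jitter.

(* K and U are the coordinate projections under the product measure, i.e.
   K and U are independent; jittered_multinomialP shows that this choice of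
   the underlying probability space is immaterial *)
Definition jittered_multinomial n (p : 'rV[R]_d) : set (Rn R d) -> \bar R :=
  distribution (multinomial_prob n p \x uniform_cube)%E jitter.

HB.instance Definition _ n p := Probability.on (jittered_multinomial n p).

Lemma jittered_multinomialP n (p : 'rV[R]_d) (disp : measure_display)
    (Omega : measurableType disp) (P : probability Omega R)
    (K : {RV P >-> d.-tuple nat}) (U : {RV P >-> Rn R d}) :
  (forall A, measurable A -> distribution P K A = multinomial_prob n p A) ->
  (forall B : set (Rn R d), measurable B -> distribution P U B = uniform_cube B) ->
  (forall (A : set (d.-tuple nat)) (B : set (Rn R d)),
    measurable A -> measurable B ->
    P (K @^-1` A `&` U @^-1` B) = (P (K @^-1` A) * P (U @^-1` B))%E) ->
  forall A : set (Rn R d), measurable A ->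
    P ((fun w => [tuple (tnth (K w) i)%:R + tnth (U w) i : R | i < d])
      @^-1` A) = jittered_multinomial n p A.
Proof.
move=> hK hU hKU A mA.
have mKU : measurable_fun setT (fun w => (K w, U w)).
  exact/measurable_fun_pair.
pose KU : {mfun Omega >-> (d.-tuple nat * Rn R d)%type} :=
  HB.pack (fun w => (K w, U w)) (@isMeasurableFun.Build _ _ _ _ _ mKU).
transitivity (distribution P KU (jitter @^-1` A)) => //.
apply/esym; apply: product_measure_unique; last first.
  by rewrite -[X in measurable X]setTI; exact: measurable_jitter.
move=> B C mB mC; transitivity (distribution P K B * distribution P U C)%E.
  exact: hKU.
by rewrite hK// hU.
Qed.

End jittered_multinomial.

Section mvnormal.
Context {R : realType} {d : nat}.
Implicit Types (m : 'rV[R]_d) (Sigma : 'M[R]_d) (x : Rn R d).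

Definition row_of_tuple x : 'rV[R]_d := \row_i tnth x i.

Definition mvnormal_pdf m Sigma x : R :=
  let y := row_of_tuple x - m in
  expR (- (y *m invmx Sigma *m y^T) 0 0 / 2) /
  Num.sqrt ((2 * pi) ^+ d * \det Sigma).

Lemma mvnormal_pdf_ge0 m Sigma x : 0 <= mvnormal_pdf m Sigma x.
Proof. by rewrite divr_ge0// expR_ge0. Qed.

Lemma measurable_mvnormal_pdf m Sigma :
  measurable_fun setT (mvnormal_pdf m Sigma).
Proof.
have mrow j : measurable_fun setT (fun x => (row_of_tuple x - m) 0 j).
  rewrite (_ : (fun _ => _) = fun x => tnth x j - m 0 j); last first.
    by apply/funext => x; rewrite !mxE.
  apply: measurable_funB => //.
  exact: measurable_tnth.
apply: measurable_funM => //.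
apply: measurableT_comp => //; apply: measurable_funM => //.
apply: measurableT_comp => //.
rewrite (_ : (fun _ => _) = fun x =>
    \sum_j (\sum_i (row_of_tuple x - m) 0 i * invmx Sigma i j) *
           (row_of_tuple x - m) 0 j); last first.
  apply/funext => x; rewrite mxE; apply: eq_bigr => j _.
  by rewrite mxE [in X in _ * X]mxE.
apply: measurable_sum => j; apply: measurable_funM => //.
by apply: measurable_sum => i; apply: measurable_funM.
Qed.

(* Normal_d(m, Sigma), for Sigma positive definite *)
Definition mvnormal_prob m Sigma : set (Rn R d) -> \bar R := fun A =>
  (\int[power_measure lebesgue_measure d]_(x in A) (mvnormal_pdf m Sigma x)%:E)%E.

Section instances.
Variables (m : 'rV[R]_d) (Sigma : 'M[R]_d).
Local Notation normal := (mvnormal_prob m Sigma).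

Let mvnormal0 : normal set0 = 0%E.
Proof. by rewrite /mvnormal_prob integral_set0. Qed.

Let mvnormal_ge0 A : (0 <= normal A)%E.
Proof. by apply: integral_ge0 => x _; rewrite lee_fin mvnormal_pdf_ge0. Qed.

Let mvnormal_sigma_additive : semi_sigma_additive normal.
Proof.
move=> F mF tF mUF; rewrite /mvnormal_prob; apply: cvg_toP.
  apply: ereal_nondecreasing_is_cvgn => a b ab.
  apply: lee_sum_nneg_natr => // k _ _.
  by apply: integral_ge0 => x _; rewrite lee_fin mvnormal_pdf_ge0.
rewrite ge0_integral_bigcup//=.
- apply: (@measurable_funS _ _ _ _ setT) => //.
  by apply/measurable_EFinP; exact: measurable_mvnormal_pdf.
- by move=> x _; rewrite lee_fin mvnormal_pdf_ge0.
Qed.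

HB.instance Definition _ := isMeasure.Build _ _ _ normal
  mvnormal0 mvnormal_ge0 mvnormal_sigma_additive.

End instances.
End mvnormal.

Definition multinomial_cov {R : realType} {d : nat} (p : 'rV[R]_d) : 'M[R]_d :=
  diag_mx p - p^T *m p.

Definition tv_dist {disp : measure_display} {T : measurableType disp}
    {R : realType} (mu nu : {measure set T -> \bar R}) : \bar R :=
  ereal_sup [set `|mu A - nu A|%E | A in measurable].

(* Main.v *)
Require Import Defs.
From mathcomp Require Import all_boot all_order all_algebra.
From mathcomp Require Import all_classical all_reals all_analysis.
From mathcomp Require Import measurable_realfun zify ring lra.
Set Implicit Arguments.
Unset Strict Implicit.
Unset Printing Implicit Defensive.
Import Order.TTheory GRing.Theory Num.Theory.
Import numFieldNormedType.Exports.
Local Open Scope classical_set_scope.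
Local Open Scope ring_scope.

(** The comparison goes through relative entropy.  Write P(k) for the
    multinomial mass function, q for the normal density and U for the uniform
    jitter.  The unit cells around the lattice points are disjoint, so the
    Lebesgue integral of a nonnegative function is at least the sum over k of
    its averages over k + U ([sum_uniform_cube_le]).  Hence the normal law gives
    A at least the sum over k of E[1_A(k + U) q(k + U)], whereas the jittered
    law gives it the sum over k of P(k) E[1_A(k + U)] ([jittered_multinomialE]).
    If L bounds log (P(k) / q(k + u)) from above, the comparison of the
    Hellinger distance with relative entropy and the inequality between the
    arithmetic and geometric means give, for every e > 0,
      P 1_A <= q 1_A + (2/e) q + P e/2 + (2/e) (P L - P)
    ([mass_le_density]).  Summed over k, and since q has total mass 1
    ([mvnormal_prob_setT]), the two terms of size 2/e cancel: the jittered law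
    exceeds the normal law on A by at most e/2 + (2/e) E[L], which is at most e
    once E[L] <= e^2/4 ([jittered_le_normal]).  Passing to complements turns
    this one-sided bound into a bound on total variation ([tv_dist_le]).

    The entropy E[L] is small for the following reasons.  The covariance matrix
    has an explicit inverse and determinant, so log q(x) is, up to a constant,
    minus half the sum over all d + 1 categories of the squared deviations
    divided by n p_i ([multinomial_mvnormal_pdfE]).  Only two facts about
    factorials matter: s_n = log n! - (n + 1/2) log n + n is nonincreasing, so
    that s_n compares log k! for k <= n with its Stirling approximation
    ([ln_fact_ge]), and s_n >= log(2 pi)/2 ([stirling_rem_lb]), by Wallis'
    product.  Thus n! contributes s_n once, the d + 1 factorials k_i! contribute
    it d + 1 times with the opposite sign, and the remaining -d s_n is absorbed
    by the normalising constant of q.  What is left of log P(k) is a sum over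
    the categories of terms -k_i log (k_i / (n p_i)), whose quadratic Taylor
    terms cancel the exponent of q.  The error in each category is a cubic and
    some lower-order corrections ([stirling_excess]); since K_i is binomial, its
    mean is at most (7/6) / (n p_i) ([expected_stirling_excess]).  The part of L
    that is linear in the jitter has mean 0, and the quadratic part has mean of
    order d^2 (d + 1) tau / n.  Altogether E[L] is at most
    (7/6 + d^2/8) (d + 1) tau / n, and d + 1 <= tau makes this smaller than
    a quarter of the square of the claimed bound. *)

(** * Logarithms and the Wallis integrals *)

Section log_bounds.
Context {R : realType}.
Implicit Types (x : R) (n : nat).

(** The cubic Taylor polynomial of x log x at 1 lies below the function on the
    whole half-line.  After division by x the difference has derivative
    (x - 1)^3 / (3 x^2), so that it is smallest at 1, where it vanishes. *)
Lemma ln_cubic_lb x : 0 < x ->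
  (x - 1) + (x - 1) ^+ 2 / 2 - (x - 1) ^+ 3 / 6 <= x * ln x.
Proof.
move=> x0.
pose f (y : R) := ln y + y ^+ 2 / 6 - y + 2^-1 + y^-1 / 3.
pose df (y : R) := (y - 1) ^+ 3 / (3 * y ^+ 2).
have f1 : f 1 = 0 by rewrite /f ln1 invr1; lra.
have fE : x * f x = x * ln x -
    ((x - 1) + (x - 1) ^+ 2 / 2 - (x - 1) ^+ 3 / 6).
  by rewrite /f; field; rewrite gt_eqF.
have dfE (y : R) : 0 < y -> is_derive y 1 f (df y).
  move=> y0; have yn0 : y != 0 by rewrite gt_eqF.
  have h1 := is_derive1_ln y0.
  have h2 : is_derive y 1 (fun z : R => z^-1) (- y ^- 2).
    apply: is_derive_eq; first exact: (is_deriveV (f := id)).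
    by rewrite /GRing.scale/= mulr1.
  rewrite /f /df; apply: is_derive_eq.
  rewrite /GRing.scale/=; field.
  by rewrite yn0.
have cf (y : R) : 0 < y -> {for y, continuous f}.
  by move=> /dfE[+ _] => /derivable1_diffP/differentiable_continuous.
suff f0 : 0 <= f x by rewrite -subr_ge0 -fE mulr_ge0// ltW.
case: (ltgtP x 1) => [x1|x1|x1]; last by rewrite x1 f1.
- have [y] : exists2 c, c \in `]x, 1[%R & f 1 - f x = df c * (1 - x).
    apply: MVT => //.
      by move=> y; rewrite in_itv/= => /andP[xy _]; apply/dfE; exact: lt_trans xy.
    apply: continuous_in_subspaceT => y; rewrite inE/= in_itv/= => /andP[xy _].
    by apply: cf; exact: lt_le_trans xy.
  rewrite in_itv/= => /andP[xy y1]; rewrite f1 sub0r => e.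
  rewrite -oppr_le0 e mulr_le0_ge0 ?subr_ge0 ?(ltW x1)//.
  rewrite /df pmulr_lle0; last by rewrite invr_gt0 mulr_gt0// exprn_gt0// (lt_trans x0).
  by rewrite exprn_odd_le0// subr_le0 ltW.
- have [y] : exists2 c, c \in `]1, x[%R & f x - f 1 = df c * (x - 1).
    apply: MVT => //.
      by move=> y; rewrite in_itv/= => /andP[xy _]; apply/dfE; exact: lt_trans xy.
    apply: continuous_in_subspaceT => y; rewrite inE/= in_itv/= => /andP[xy _].
    by apply: cf; exact: lt_le_trans xy.
  rewrite in_itv/= => /andP[xy y1]; rewrite f1 subr0 => ->.
  rewrite mulr_ge0 ?subr_ge0 ?(ltW x1)//.
  have y0 : 0 <= y by rewrite (le_trans ler01)// ltW.
  by rewrite /df divr_ge0 ?mulr_ge0 ?exprn_ge0 ?subr_ge0 ?(ltW xy).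
Qed.

End log_bounds.

Section wallis.
Context {R : realType}.
Local Notation mu := (@lebesgue_measure R).

Definition wallis n : R := \int[mu]_(x in `[0, pi]) (sin x ^+ n).

Lemma is_derive_sinX n (x : R) :
  is_derive x 1 (fun x : R => sin x ^+ n) (n%:R * sin x ^+ n.-1 * cos x).
Proof.
by have := @is_deriveX R R sin n x 1 (cos x) (is_derive_sin x); rewrite exprfctE.
Qed.

Lemma continuous_sinX n : continuous (fun x : R => sin x ^+ n).
Proof.
move=> x; have [d _] := is_derive_sinX n x.
exact/differentiable_continuous/derivable1_diffP.
Qed.

Lemma integrable_sinX n : mu.-integrable `[0, pi] (fun x : R => (sin x ^+ n)%:E).
Proof.
apply: continuous_compact_integrable; first exact: segment_compact.
exact/continuous_subspaceT/continuous_sinX.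
Qed.

Lemma wallis0 : wallis 0 = pi.
Proof.
rewrite /wallis; under eq_Rintegral do rewrite expr0.
rewrite Rintegral_cst//= (lebesgue_measure_itv `[0, pi])/= lte_fin pi_gt0 mul1r.
by rewrite -EFinB/= subr0.
Qed.

Lemma Rintegral_derivative (f F : R -> R) : continuous f ->
  (forall x : R, is_derive x 1 F (f x)) ->
  \int[mu]_(x in `[0, pi]) f x = F pi - F 0.
Proof.
move=> cf dF; rewrite /Rintegral (@continuous_FTC2 R f F) ?pi_gt0//.
- exact: continuous_subspaceT.
- have cF x : {for x, continuous F}.
    by have [+ _] := dF x => /derivable1_diffP/differentiable_continuous.
  split; first by move=> x _; have [] := dF x.
  + by apply: cvg_at_right_filter; exact: cF.
  + by apply: cvg_at_left_filter; exact: cF.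
- by move=> x _; rewrite derive1E; have [_ ->] := dF x.
Qed.

Lemma wallis1 : wallis 1 = 2.
Proof.
apply: eq_trans (@Rintegral_derivative (fun x => sin x ^+ 1) (fun x => - cos x)
  _ _) _; last 1 first.
- by rewrite cos0 cospi; lra.
- exact: continuous_sinX.
- by move=> x; apply: is_derive_eq; rewrite opprK expr1.
Qed.

(** The recurrence integrates the derivative of cos x sin^(n+1) x, which vanishes at
    both ends of the interval. *)
Lemma wallisSS n : n.+2%:R * wallis n.+2 = n.+1%:R * wallis n.
Proof.
apply/esym/eqP; rewrite -subr_eq0; apply/eqP.
have -> : n.+1%:R * wallis n - n.+2%:R * wallis n.+2 =
    \int[mu]_(x in `[0, pi]) (n.+1%:R * sin x ^+ n - n.+2%:R * sin x ^+ n.+2).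
  rewrite RintegralB//;
    try by apply: eq_integrable (integrableZl _ _ (integrable_sinX _)) => //.
  by rewrite !RintegralZl//; exact: integrable_sinX.
apply: eq_trans (@Rintegral_derivative
  (fun x => n.+1%:R * sin x ^+ n - n.+2%:R * sin x ^+ n.+2)
  (fun x => cos x * sin x ^+ n.+1) _ _) _; last 1 first.
- by rewrite sin0 sinpi !exprS !mul0r !mulr0 subrr.
- by move=> x; apply: cvgB; apply: cvgMr; exact: continuous_sinX.
- move=> x; have h1 := is_derive_sinX n.+1 x.
  apply: is_derive_eq; rewrite /GRing.scale/=.
  have h : cos x ^+ 2 = 1 - sin x ^+ 2 by rewrite -(cos2Dsin2 x) addrK.
  rewrite !exprS -!natr1.
  transitivity ((n%:R + 1) * sin x ^+ n * cos x ^+ 2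
    - sin x ^+ 2 * sin x ^+ n : R); first by ring.
  by rewrite h; ring.
Qed.

Lemma wallis_ge0 n : 0 <= wallis n.
Proof.
by apply: Rintegral_ge0 => x; rewrite /= in_itv/= => xpi; rewrite exprn_ge0// sin_ge0_pi.
Qed.

Lemma wallis_nonincr n : wallis n.+1 <= wallis n.
Proof.
apply: le_Rintegral => //; try exact: integrable_sinX.
move=> x; rewrite /= in_itv/= => xpi.
by rewrite exprS ler_piMl ?sin_le1// exprn_ge0// sin_ge0_pi.
Qed.

(** The recurrence makes the left-hand side independent of n. *)
Lemma wallis_mul n : n.+1%:R * (wallis n.+1 * wallis n) = 2 * pi.
Proof.
elim: n => [|n IH]; first by rewrite wallis0 wallis1 mul1r.
by rewrite mulrA wallisSS -mulrA [X in _ * X]mulrC.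
Qed.

Lemma wallis_even n : wallis n.*2 * (4 ^+ n) = pi * 'C(n.*2, n)%:R.
Proof.
elim: n => [|n IH]; first by rewrite wallis0 bin0 mulr1.
have n1 : n.+1%:R != 0 :> R by rewrite pnatr_eq0.
have n2 : n.*2.+2%:R != 0 :> R by rewrite pnatr_eq0.
have h : (n.+1 * 'C(n.+1.*2, n.+1) = 2 * (n.*2.+1 * 'C(n.*2, n)))%N.
  rewrite doubleS.
  have e1 : (n.*2.+1 * 'C(n.*2, n) = n.+1 * 'C(n.*2.+1, n.+1))%N := mul_bin_diag n.*2.+1 n.
  have e2 : 'C(n.*2.+1, n.+1) = 'C(n.*2.+1, n).
    by rewrite -bin_sub; [congr 'C(_, _)|]; rewrite -addnn; lia.
  by rewrite e1 binS -e2; lia.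
have := wallisSS n.*2 => /(congr1 (fun z => z * 4 ^+ n)).
rewrite -!mulrA IH => e.
apply: (mulfI n1); rewrite [RHS]mulrCA -natrM h !natrM doubleS.
rewrite exprS; move: e.
have -> : n.*2.+2%:R = 2 * n.+1%:R :> R by rewrite -natrM; congr (_%:R); rewrite -addnn; lia.
move=> e; transitivity (2 * (2 * n.+1%:R * (wallis n.*2.+2 * 4 ^+ n))); first by ring.
by rewrite e; ring.
Qed.

(** Wallis' inequality, C(2N,N) <= 4^N / sqrt(pi N) with N = n + 1: the even integral
    W_2N = pi C(2N,N) / 4^N is at most W_(2N-1), and 2N W_2N W_(2N-1) = 2 pi. *)
Lemma central_binomial_le n :
  pi * n.+1%:R * 'C(n.+1.*2, n.+1)%:R ^+ 2 <= (4 ^+ n.+1) ^+ 2 :> R.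
Proof.
have w := wallis_even n.+1.
have m := wallis_mul n.*2.+1.
have p0 := pi_gt0 R.
have le : wallis n.+1.*2 ^+ 2 * n.+1%:R <= pi.
  have : n.*2.+2%:R * (wallis n.*2.+2 * wallis n.*2.+2) <= 2 * pi.
    by rewrite -m ler_wpM2l// ler_wpM2l ?wallis_ge0// wallis_nonincr.
  have -> : n.*2.+2%:R = 2 * n.+1%:R :> R by rewrite -natrM; congr (_%:R); rewrite -addnn; lia.
  rewrite doubleS expr2; lra.
rewrite -(ler_pM2l p0).
have -> : pi * (pi * n.+1%:R * 'C(n.+1.*2, n.+1)%:R ^+ 2) =
  (wallis n.+1.*2 ^+ 2 * n.+1%:R) * (4 ^+ n.+1) ^+ 2.
  transitivity ((pi * 'C(n.+1.*2, n.+1)%:R) ^+ 2 * n.+1%:R : R); first by ring.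
  by rewrite -w; ring.
by rewrite ler_wpM2r// exprn_ge0// exprn_ge0.
Qed.

End wallis.

(** * Stirling lower bounds for factorials *)

Section stirling.
Context {R : realType}.
Implicit Types n k : nat.

Definition stirling_rem n : R := ln n`!%:R - (n%:R + 2^-1) * ln n%:R + n%:R.

Lemma stirling_rem1 : stirling_rem 1 = 1.
Proof. by rewrite /stirling_rem (_ : 1`! = 1)%N// ln1 mulr0 subrr add0r. Qed.

Lemma ln_factS n : ln n.+1`!%:R = ln n.+1%:R + ln n`!%:R :> R.
Proof. by rewrite factS natrM lnM// posrE ltr0n ?fact_gt0. Qed.

(** This is [ln_cubic_lb] at 1 + 1/(n+1): after scaling the cubic by the right
    factor, the excess over 1 is nonnegative because n + 1 >= 1. *)
Lemma ln_succ_lb n : 1 <= (n.+1%:R + 2^-1) * (ln n.+2%:R - ln n.+1%:R) :> R.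
Proof.
have n0 : 0 < n.+1%:R :> R by [].
have n1 : n.+1%:R != 0 :> R by [].
rewrite -ln_div ?posrE//.
have := @ln_cubic_lb R (n.+2%:R / n.+1%:R) (divr_gt0 (ltr0Sn _ _) n0).
set l := ln _; rewrite -[n.+2%:R]natr1; set m : R := n.+1%:R in n0 n1 *.
have m1 : 1 <= m by rewrite ler1n.
set a := (X in X <= _ -> _) => h.
have -> : (m + 2^-1) * l = (m * (m + 2^-1) / (m + 1)) * ((m + 1) / m * l).
  by field; apply/andP; split => //; rewrite gt_eqF// addr_gt0.
apply: le_trans (ler_wpM2l _ h); last by rewrite divr_ge0 ?mulr_ge0 ?addr_ge0// ltW.
have -> : m * (m + 2^-1) / (m + 1) * a = 1 + (m - 1) / (12 * m ^+ 2 * (m + 1)).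
  by rewrite /a; field; apply/andP; split => //; rewrite gt_eqF// addr_gt0.
rewrite lerDl divr_ge0 ?subr_ge0 ?mulr_ge0 ?exprn_ge0 ?addr_ge0//; exact: ltW.
Qed.

Lemma stirling_rem_decr n : stirling_rem n.+2 <= stirling_rem n.+1.
Proof.
rewrite /stirling_rem ln_factS -[n.+2%:R in X in _ - X * _ + _]natr1.
rewrite -[n.+2%:R in X in _ + X]natr1.
have := ln_succ_lb n; set a := ln n.+2%:R; set b := ln n.+1%:R.
set c := ln _; set m : R := n.+1%:R => h.
rewrite -subr_ge0.
have -> : c - (m + 2^-1) * b + m - (a + c - (m + 1 + 2^-1) * a + (m + 1)) =
  (m + 2^-1) * (a - b) - 1 by field.
by rewrite subr_ge0.
Qed.

Lemma stirling_rem_nonincr k n : (0 < k)%N -> (k <= n)%N ->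
  stirling_rem n <= stirling_rem k.
Proof.
case: k => // k _; elim: n => // n IH; rewrite leq_eqVlt => /predU1P[->//|].
rewrite ltnS => kn; apply: le_trans (IH kn).
by case: n kn {IH} => // n _; exact: stirling_rem_decr.
Qed.

Lemma ln_fact_lb n : n%:R * ln n%:R - n%:R <= ln n`!%:R :> R.
Proof.
elim: n => [|[|n] IH]; first by rewrite mul0r fact0 ln1 subr0.
  by rewrite (_ : 1`! = 1)%N// ln1 mulr0 sub0r lerN10.
rewrite ln_factS -[n.+2%:R in X in X * _]natr1 -[n.+2%:R in X in _ - X]natr1.
have h : n.+1%:R * (ln n.+2%:R - ln n.+1%:R) <= 1 :> R.
  rewrite -ln_div ?posrE// -ler_pdivlMl// mulr1.
  have -> : n.+2%:R / n.+1%:R = 1 + n.+1%:R^-1 :> R.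
    by rewrite -natr1 mulrDl divff// mul1r addrC addrC.
  by apply: le_ln1Dx; rewrite (lt_trans (ltrN10 _)) ?invr_gt0.
move: IH h; set a := ln n.+2%:R; set b := ln n.+1%:R.
set c := ln _; set m : R := n.+1%:R => IH h; lra.
Qed.

(** The combination 2 s_N - s_2N is log (4^N / C(2N,N)) - log (N/2) / 2, so Wallis'
    inequality bounds it below by log(2 pi) / 2. *)
Lemma stirling_rem_double n :
  ln (2 * pi) / 2 + stirling_rem n.+1.*2 <= 2 * stirling_rem n.+1.
Proof.
have n0 : 0 < n.+1%:R :> R by [].
have p0 := pi_gt0 R.
have b0 : 0 < 'C(n.+1.*2, n.+1)%:R :> R by rewrite ltr0n bin_gt0 -addnn leq_addr.
have h := central_binomial_le (R := R) n.
have hl : ln pi + ln n.+1%:R + 2 * ln 'C(n.+1.*2, n.+1)%:R <= 4 * n.+1%:R * ln 2 :> R.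
  have -> : 4 * n.+1%:R * ln 2 = ln ((4 ^+ n.+1) ^+ 2) :> R.
    have -> : ln ((4 ^+ n.+1) ^+ 2) = ln ((2 : R) ^+ (4 * n.+1)).
      congr ln; rewrite (_ : 4 = 2 ^+ 2 :> R); last by rewrite expr2; lra.
      by rewrite -!exprM; congr (_ ^+ _); lia.
    by rewrite lnXn// -[RHS]mulr_natl natrM.
  rewrite [2 * _]mulr_natl -lnXn// -!lnM ?posrE ?mulr_gt0 ?exprn_gt0//.
  by rewrite ler_ln ?posrE ?mulr_gt0 ?exprn_gt0.
have fE : ln n.+1.*2`!%:R = ln 'C(n.+1.*2, n.+1)%:R + 2 * ln n.+1`!%:R :> R.
  have := @bin_fact n.+1.*2 n.+1; rewrite -addnn leq_addr addnK => /(_ erefl) <-.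
  by rewrite !natrM !lnM ?posrE ?mulr_gt0 ?ltr0n ?fact_gt0 ?bin_gt0 ?leq_addr//; lra.
rewrite /stirling_rem fE.
have -> : n.+1.*2%:R = 2 * n.+1%:R :> R by rewrite -muln2 natrM mulrC.
rewrite !lnM ?posrE//.
move: hl; set a := ln pi; set b := ln n.+1%:R; set c := ln 'C(_, _)%:R.
set e := ln 2; set f := ln _; set m : R := n.+1%:R => hl.
nra.
Qed.

(** The limit of s_n is never computed.  If s_n were below a = log(2 pi)/2, repeated
    doubling by [stirling_rem_double] would give a - s_(2^j n) >= 2^j (a - s_n),
    which the crude bound s_m >= - log m / 2 excludes for large j. *)
Lemma stirling_rem_lb n : (0 < n)%N -> ln (2 * pi) / 2 <= stirling_rem n.
Proof.
move=> n0.
pose a : R := ln (2 * pi) / 2.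
have it j : (2 ^ j)%:R * (a - stirling_rem n) <= a - stirling_rem (n * 2 ^ j)%N.
  elim: j => [|j IH]; first by rewrite muln1 mul1r.
  rewrite expnS mulnCA natrM -mulrA.
  apply: (@le_trans _ _ (2 * (a - stirling_rem (n * 2 ^ j)))); first by rewrite ler_pM2l.
  rewrite mul2n; have : (0 < n * 2 ^ j)%N by rewrite muln_gt0 n0 expn_gt0.
  case: (n * 2 ^ j)%N => // k _; have := stirling_rem_double k.
  rewrite -/a; lra.
rewrite -/a -subr_le0 leNgt; apply/negP => d0.
have b j : (2 ^ j)%:R * (a - stirling_rem n) <= a + (ln n%:R + j%:R) / 2.
  apply: le_trans (it j) _; rewrite lerD2l.
  have := ln_fact_lb (n * 2 ^ j); rewrite /stirling_rem.
  have -> : ln (n * 2 ^ j)%:R = ln n%:R + j%:R * ln 2 :> R.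
    by rewrite natrM natrX lnM ?posrE ?exprn_gt0 ?ltr0n// lnXn// mulr_natl.
  have l2 : ln 2 <= 1 :> R.
    by have := @le_ln1Dx R 1; apply; rewrite (lt_trans (ltrN10 _)).
  have : j%:R * ln 2 <= j%:R :> R by rewrite ler_piMr.
  lra.
(* a quadratic minorant of 2^j is enough to beat the linear right-hand side *)
pose c := a - stirling_rem n; pose e : R := a + ln n%:R / 2.
have b' j : (j.+1%:R)^+2 / 4 * c <= e + j%:R.
  have h := b j; rewrite -/c in h.
  have : (j.+1%:R)^+2 / 4 * c <= (2 ^ j)%:R * c.
    rewrite ler_pM2r//; rewrite ler_pdivrMr// -natrX -natrM ler_nat.
    elim: j {h} => [//|[//|[//|[//|[//|j]]]] IH]; rewrite [(2 ^ _.+1)%N]expnS.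
    by move: IH; set t := (2 ^ _)%N; nia.
  move=> h2; apply: (le_trans h2); apply: (le_trans h); rewrite /e.
  by have : 0 <= j%:R :> R by []; lra.
have c0 : 0 < c by [].
have [k hk] : exists k : nat, 4 * (`|e| + 2) / c < k%:R.
  by exists (Num.truncn (4 * (`|e| + 2) / c)).+1; rewrite truncnS_gt.
have hk' : 4 * (`|e| + 2) < k.+1%:R * c.
  by rewrite -ltr_pdivrMr// (lt_trans hk)// ltr_nat.
have h := b' k.
have k1 : 1 <= k.+1%:R :> R by rewrite ler1n.
have ee : e <= `|e| := ler_norm e.
have e0 : 0 <= `|e| by [].
have kk : k%:R = k.+1%:R - 1 :> R by rewrite -natr1 addrK.
move: h hk' k1; rewrite kk; set K := k.+1%:R; move=> h hk' k1.
have : K * (4 * (`|e| + 2)) <= K * (K * c) by rewrite ler_pM2l ?(lt_le_trans ltr01)// ltW.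
nra.
Qed.

(** A form of Stirling's lower bound that remains valid at k = 0 (where ln 0 = 0): the
    logarithm of k is replaced by that of k + 1 in the square-root factor, at the
    cost of 1/(k+1).  The constant is s_n itself instead of its limit: for k >= 1
    the sequence s is nonincreasing, and for k = 0 one has s_n <= s_1 = 1. *)
Lemma ln_fact_ge k n : (0 < n)%N -> (k <= n)%N ->
  k%:R * ln k%:R - k%:R + ln k.+1%:R / 2 - k.+1%:R^-1 + stirling_rem n
    <= ln k`!%:R.
Proof.
move=> n0; case: k => [_|k kn].
  rewrite !mul0r ln1 invr1 mul0r.
  have := @stirling_rem_nonincr 1 n erefl n0; rewrite stirling_rem1; lra.
have := @stirling_rem_nonincr k.+1 n erefl kn; rewrite {2}/stirling_rem.
have : ln k.+2%:R - ln k.+1%:R <= 2 * k.+2%:R^-1 :> R.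
  rewrite -ln_div ?posrE//.
  have -> : k.+2%:R / k.+1%:R = 1 + k.+1%:R^-1 :> R.
    by rewrite -[k.+2%:R]natr1 mulrDl divff// mul1r.
  apply: (@le_trans _ _ k.+1%:R^-1).
    by apply: le_ln1Dx; rewrite (lt_trans (ltrN10 _)) ?invr_gt0.
  by rewrite ler_pdivlMr// ler_pdivrMl// -natrM ler_nat; lia.
set a := ln k.+2%:R; set b := ln k.+1%:R; set m : R := k.+1%:R; set c := _^-1.
set s := stirling_rem n; set f := ln _.
by clearbody a b m c s f; lra.
Qed.

End stirling.

(** * Sums over the multinomial distribution and binomial moments *)

Section categories.
Context {R : realType} {d : nat}.
Implicit Types (p : 'rV[R]_d) (k : d.-tuple nat) (n : nat).

Lemma sum_all_probs p : \sum_i all_probs p i = 1.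
Proof.
rewrite (bigD1_ord ord_max)//= /all_probs unlift_none.
by under eq_bigr do rewrite liftK; rewrite subrK.
Qed.

Lemma sum_all_counts n k : (\sum_j tnth k j <= n)%N ->
  (\sum_i all_counts n k i)%N = n.
Proof.
move=> kn; rewrite (bigD1_ord ord_max)//= /all_counts unlift_none.
by under eq_bigr do rewrite liftK; rewrite subnK.
Qed.

Lemma all_counts_le n k i : (\sum_j tnth k j <= n)%N -> (all_counts n k i <= n)%N.
Proof.
move=> /sum_all_counts; rewrite (bigD1 i)//= => /(congr1 (leq _)) <-.
exact: leq_addr.
Qed.

Lemma all_probs_row (q : 'I_d.+1 -> R) : \sum_i q i = 1 ->
  all_probs (\row_j q (lift ord_max j)) = q.
Proof.
move=> q1; apply/funext => i; rewrite /all_probs.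
case: unliftP => [j ->|->]; first by rewrite mxE.
under eq_bigr do rewrite mxE.
by move: q1; rewrite (bigD1_ord ord_max)//= => <-; rewrite addrK.
Qed.

Lemma all_probs_gt0 p i : open_simplex p -> 0 < all_probs p i.
Proof.
move=> [p0 p1]; rewrite /all_probs; case: unliftP => [j _|_].
  by have /andP[] := p0 j.
by rewrite subr_gt0.
Qed.

Lemma simplex_row (q : 'I_d.+1 -> R) : (forall i, 0 <= q i) ->
  \sum_i q i = 1 -> simplex (\row_j q (lift ord_max j)).
Proof.
move=> q0 q1; have q01 : \sum_j q (lift ord_max j) <= 1.
  by rewrite -q1 [leRHS](bigD1_ord ord_max)//= lerDr.
split; last by under eq_bigr do rewrite mxE.
move=> j; rewrite mxE q0/= (le_trans _ q01)//.
by rewrite (bigD1 j)//= lerDl sumr_ge0.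
Qed.

Lemma open_simplexW p : open_simplex p -> simplex p.
Proof.
move=> [p0 p1]; split; last exact: ltW.
by move=> i; have /andP[? ?] := p0 i; rewrite !ltW.
Qed.

End categories.

Section multinomial_sums.
Context {R : realType} {d : nat}.
Variable n : nat.
Implicit Types (p : 'rV[R]_d).

(** The multinomial law charges only vectors of counts at most n, which makes sums over
    it finite: they range over the image of a finite type of tuples. *)
Definition counts_of (w : d.-tuple 'I_n.+1) : d.-tuple nat := map_tuple val w.

Lemma counts_of_inj : injective counts_of.
Proof. by move=> u v /(congr1 val)/= /(inj_map val_inj)/val_inj. Qed.

Lemma counts_of_surj (k : d.-tuple nat) : (\sum_j tnth k j <= n)%N ->
  exists w, counts_of w = k.
Proof.
move=> kn; exists [tuple inord (tnth k i) | i < d].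
apply: eq_from_tnth => i; rewrite tnth_map tnth_mktuple /= inordK// ltnS.
by apply: leq_trans kn; rewrite (bigD1 i)//= leq_addr.
Qed.

Lemma sum_multinomial_pmf p : simplex p ->
  \sum_(w : d.-tuple 'I_n.+1) multinomial_pmf n p (counts_of w) = 1.
Proof.
move=> sp; apply: EFin_inj; rewrite -(multinomial_pmf_sum1 n sp).
have pmf0 k : (0 <= (multinomial_pmf n p k)%:E)%E by rewrite lee_fin multinomial_pmf_ge0.
rewrite (esumID (range counts_of))//= !setTI.
rewrite [X in (_ + X)%E]esum1 ?adde0; last first.
  move=> k /= rk; rewrite /multinomial_pmf ifF//; apply/negP => kn.
  by apply: rk; have [w <-] := counts_of_surj kn; exists w.
rewrite (@reindex_esum _ _ _ setT _ counts_of)//; last first.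
  split; last by move=> k [w _ <-]; exists w.
  - by move=> w _; exists w.
  - by move=> u v _ _; exact: counts_of_inj.
rewrite esum_fset//; last exact: finite_finset.
rewrite -sumEFin; rewrite fsbig_seq ?index_enum_uniq//; apply: eq_fsbigl.
by apply/seteqP; split => // w _; rewrite /= mem_index_enum.
Qed.

(** The probability generating function of the i-th count.  Multiplying the i-th
    probability by t and renormalising by S gives another multinomial law, whose
    masses are those of p times t^(k_i) / S^n and sum to 1. *)
Lemma sum_multinomial_pmf_tilted p i (t : R) : open_simplex p -> 0 < t ->
  \sum_(w : d.-tuple 'I_n.+1) multinomial_pmf n p (counts_of w) *
     t ^+ all_counts n (counts_of w) i
  = (1 - all_probs p i + all_probs p i * t) ^+ n.
Proof.
move=> op t0.
pose c (j : 'I_d.+1) := if j == i then t else 1.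
pose S := 1 - all_probs p i + all_probs p i * t.
have SE : \sum_j all_probs p j * c j = S.
  rewrite /S -(sum_all_probs p) (bigD1 i)//= [in RHS](bigD1 i)//= /c eqxx.
  rewrite [X in X - _]addrC addrK addrC; congr +%R; apply: eq_bigr => j /negPf ->.
  by rewrite mulr1.
have p0 j : 0 < all_probs p j by exact: all_probs_gt0.
have c0 j : 0 < c j by rewrite /c; case: ifP.
have S0 : 0 < S.
  by rewrite -SE (bigD1 i)//= ltr_pwDl ?mulr_gt0// sumr_ge0// => j _; rewrite ltW ?mulr_gt0.
pose q j := all_probs p j * c j / S.
have q1 : \sum_j q j = 1 by rewrite -mulr_suml SE divff// gt_eqF.
have q0 j : 0 <= q j by rewrite /q ltW// divr_gt0// mulr_gt0.
pose p' : 'rV_d := \row_j q (lift ord_max j).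
have := sum_multinomial_pmf (simplex_row q0 q1); rewrite -/p' => e.
rewrite -/S -[LHS]mulr1 -[in LHS](divff (_ : S ^+ n != 0)); last by rewrite gt_eqF// exprn_gt0.
rewrite mulrCA -[RHS]mulr1; congr *%R; rewrite -[RHS]e mulr_suml; apply: eq_bigr => w _.
rewrite /multinomial_pmf; case: ifPn => wn; last by rewrite !mul0r.
rewrite -!mulrA; congr *%R; congr *%R.
rewrite (all_probs_row q1) /q.
under [RHS]eq_bigr do rewrite !exprMn; rewrite !big_split/= -mulrA; congr *%R.
congr *%R.
  rewrite (bigD1 i)//= /c eqxx big1 ?mulr1// => j /negPf ->; exact: expr1n.
by rewrite prodrXr sum_all_counts// exprVn.
Qed.

Definition binomial_mass (p : R) j := 'C(n, j)%:R * p ^+ j * (1 - p) ^+ (n - j).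

(** Each count, the last one included, is binomial: both sides of
    [sum_multinomial_pmf_tilted] are polynomials in t that agree at all positive
    integers, hence have the same coefficients. *)
Lemma multinomial_marginal p i (g : nat -> R) : open_simplex p ->
  \sum_(w : d.-tuple 'I_n.+1) multinomial_pmf n p (counts_of w) *
     g (all_counts n (counts_of w) i)
  = \sum_(j < n.+1) binomial_mass (all_probs p i) j * g j.
Proof.
move=> op; set b := all_probs p i.
pose P (w : d.-tuple 'I_n.+1) := multinomial_pmf n p (counts_of w).
pose G : {poly R} := \sum_(w : d.-tuple 'I_n.+1)
  P w *: 'X^(all_counts n (counts_of w) i).
pose H : {poly R} := \poly_(j < n.+1) binomial_mass b j.
have GH : G = H.
  apply/eqP; rewrite -subr_eq0; apply/eqP.
  apply: (@roots_geq_poly_eq0 _ _ [seq k.+1%:R | k <- iota 0 (size (G - H))]).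
  - apply/allP => _ /mapP[k _ ->]; rewrite /root !hornerE subr_eq0.
    rewrite horner_sum horner_poly; under eq_bigr do rewrite hornerZ hornerXn.
    rewrite sum_multinomial_pmf_tilted// -/b exprDn; apply/eqP/eq_bigr => j _.
    by rewrite exprMn -mulr_natl /binomial_mass; ring.
  - by rewrite map_inj_uniq ?iota_uniq// => u v /eqP; rewrite eqr_nat => /eqP[].
  - by rewrite size_map size_iota.
transitivity (\sum_(j < n.+1) G`_j * g j); last first.
  by apply: eq_bigr => j _; rewrite GH coef_poly ltn_ord.
under [RHS]eq_bigr do rewrite /G coef_sum mulr_suml.
rewrite exchange_big/=; apply: eq_bigr => w _.
have [wn|wn] := boolP (\sum_j tnth (counts_of w) j <= n)%N; last first.
  rewrite {1}/multinomial_pmf ifN// mul0r big1// => j _.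
  by rewrite /P /multinomial_pmf ifN// scale0r coef0 mul0r.
have kn : (all_counts n (counts_of w) i < n.+1)%N by rewrite ltnS all_counts_le.
rewrite (bigD1 (Ordinal kn))//= coefZ coefXn eqxx mulr1.
rewrite big1 ?addr0// => j /eqP/val_eqP/= jk.
by rewrite coefZ coefXn (negPf jk) mulr0 mul0r.
Qed.

End multinomial_sums.

Section binomial_moments.
Context {R : realType}.
Variable p : R.
Implicit Types n : nat.

Local Notation E n g := (\sum_(j < n.+1) binomial_mass n p j * g%R j).

(** Size biasing: it reduces all the moments below to the total mass. *)
Lemma binomial_shift n (f : nat -> R) :
  E n.+1 (fun j => j%:R * f j) = n.+1%:R * p * E n (fun j => f j.+1).
Proof.
rewrite big_ord_recl/= mul0r mulr0 add0r mulr_sumr; apply: eq_bigr => j _.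
rewrite /binomial_mass /bump/= add1n subSS exprS.
have := mul_bin_diag n.+1 j => /(congr1 (fun m => m%:R : R)); rewrite !natrM /= => e.
transitivity ((j.+1%:R * 'C(n.+1, j.+1)%:R) * (p * p ^+ j)
  * (1 - p) ^+ (n - j) * f j.+1); first by ring.
by rewrite -e; ring.
Qed.

Lemma binomial_sum1 n : E n (fun=> 1) = 1.
Proof.
transitivity ((1 - p + p) ^+ n); last by rewrite subrK expr1n.
by rewrite exprDn; apply: eq_bigr => j _; rewrite -mulr_natl /binomial_mass; ring.
Qed.

Lemma binomial_moment1 n : E n (fun j => j%:R) = n%:R * p.
Proof.
case: n => [|n]; first by rewrite big_ord1 mulr0 mul0r.
have := binomial_shift n (fun=> 1); rewrite binomial_sum1 mulr1 => <-.
by apply: eq_bigr => j _; rewrite mulr1.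
Qed.

Lemma binomial_moment2 n : E n (fun j => j%:R * (j%:R - 1)) = n%:R * (n%:R - 1) * p ^+ 2.
Proof.
case: n => [|n]; first by rewrite big_ord1 mul0r mulr0 !mul0r.
rewrite (binomial_shift n (fun j => j%:R - 1)).
under eq_bigr do rewrite -natr1 addrK.
by rewrite binomial_moment1 -natr1; ring.
Qed.

Lemma binomial_moment3 n : E n (fun j => j%:R * ((j%:R - 1) * (j%:R - 2))) =
  n%:R * (n%:R - 1) * (n%:R - 2) * p ^+ 3.
Proof.
case: n => [|n]; first by rewrite big_ord1 mul0r mulr0 !mul0r.
rewrite (binomial_shift n (fun j => (j%:R - 1) * (j%:R - 2))).
under eq_bigr => j _.
  rewrite (_ : (j.+1%:R - 1) * (j.+1%:R - 2) = j%:R * (j%:R - 1)); last first.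
    by rewrite -natr1; ring.
  over.
by rewrite binomial_moment2 -natr1; ring.
Qed.

Lemma binomial_central_moment3 n :
  E n (fun j => (j%:R - n%:R * p) ^+ 3) = n%:R * p * (1 - p) * (1 - 2 * p).
Proof.
set m := n%:R * p.
transitivity (E n (fun j => j%:R * ((j%:R - 1) * (j%:R - 2)))
  + (3 - 3 * m) * E n (fun j => j%:R * (j%:R - 1))
  + (1 - 3 * m + 3 * m ^+ 2) * E n (fun j => j%:R) - m ^+ 3 * E n (fun=> 1)).
  rewrite !mulr_sumr -sumrN -!big_split/=; apply: eq_bigr => j _.
  by ring.
rewrite binomial_moment3 binomial_moment2 binomial_moment1 binomial_sum1 /m.
ring.
Qed.

Lemma binomial_inv_succ n : 0 < p < 1 ->
  E n (fun j => j.+1%:R^-1) <= (n.+1%:R * p)^-1.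
Proof.
move=> /andP[p0 p1]; rewrite -[leRHS]mul1r ler_pdivlMr ?mulr_gt0// mulrC.
rewrite -(binomial_shift n (fun j => j%:R^-1)) -[leRHS](binomial_sum1 n.+1).
apply: ler_sum => j _; apply: ler_wpM2l.
  by rewrite /binomial_mass !mulr_ge0// exprn_ge0// ?subr_ge0 ltW.
by have [->|j0] := eqVneq (j : nat) 0%N; [rewrite mul0r|rewrite divff// pnatr_eq0].
Qed.

End binomial_moments.

(** * The logarithm of the multinomial mass function *)

Section log_likelihood.
Context {R : realType} {d : nat}.
Implicit Types (p : 'rV[R]_d) (k : d.-tuple nat) (n : nat).

(** What a category with count j and mean m contributes to the bound for log P beyond
    - (j - m) - (j - m)^2 / (2 m): the cubic Taylor term of - j log (j/m), a bound
    for - log ((j+1)/m) / 2, and the correction of [ln_fact_ge]. *)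
Definition stirling_excess (j : nat) (m : R) :=
  (j%:R - m) ^+ 3 / (6 * m ^+ 2) + (m / j.+1%:R - 1) / 2 + j.+1%:R^-1.

Lemma stirling_term_le (j : nat) (m : R) : 0 < m ->
  - (j%:R * ln j%:R) + j%:R * ln m + (ln m - ln j.+1%:R) / 2 + j.+1%:R^-1
  <= stirling_excess j m - (j%:R - m) - (j%:R - m) ^+ 2 / (2 * m).
Proof.
move=> m0; have mn0 : m != 0 by rewrite gt_eqF.
have h1 : ln m - ln j.+1%:R <= m / j.+1%:R - 1.
  rewrite -ln_div ?posrE//.
  have -> : m / j.+1%:R = 1 + (m / j.+1%:R - 1) by rewrite addrC subrK.
  rewrite [X in _ <= X - 1]addrC subrK; apply: le_ln1Dx.
  by rewrite ltrBrDl subrr divr_gt0.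
have h2 : (j%:R - m) + (j%:R - m) ^+ 2 / (2 * m) - (j%:R - m) ^+ 3 / (6 * m ^+ 2)
    <= j%:R * ln j%:R - j%:R * ln m.
  have [->|j0] := eqVneq j 0%N.
    rewrite !mul0r subrr sub0r.
    have -> : - m + (- m) ^+ 2 / (2 * m) - (- m) ^+ 3 / (6 * m ^+ 2) = - (m / 3).
      by field.
    by rewrite oppr_le0 divr_ge0// ltW.
  have jp : 0 < j%:R :> R by rewrite ltr0n lt0n.
  have := ln_cubic_lb (divr_gt0 jp m0).
  rewrite ln_div ?posrE// => /(ler_wpM2l (ltW m0)).
  have -> : m * (j%:R / m * (ln j%:R - ln m)) = j%:R * ln j%:R - j%:R * ln m by field.
  by apply: le_trans; rewrite le_eqVlt; apply/orP; left; apply/eqP; field.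
rewrite /stirling_excess; move: h1 h2.
set a := ln m - ln _; set b := m / _; set c := j.+1%:R^-1; set e := j%:R * ln j%:R.
set f := j%:R * ln m; set g := _ / (2 * m); set h := _ / (6 * _); set x := j%:R - m.
by clearbody a b c e f g h x; lra.
Qed.

Lemma ln_prodr (I : finType) (F : I -> R) : (forall i, 0 < F i) ->
  ln (\prod_i F i) = \sum_i ln (F i).
Proof.
move=> F0; have [] // : ln (\prod_i F i) = \sum_i ln (F i) /\ 0 < \prod_i F i.
apply: (big_rec2 (fun x y => ln x = y /\ 0 < x)); first by rewrite ln1.
by move=> i x y _ [<- x0]; rewrite lnM ?posrE// mulr_gt0.
Qed.

(** The second summand on the left is minus the logarithm of the normalising constant of
    the normal density.  Bounding n! by s_n and every k_i! by [ln_fact_ge] leaves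
    -d s_n <= -d log(2 pi) / 2; the linear terms k_i - n p_i sum to 0. *)
Lemma ln_multinomial_pmf_le n p k : (0 < n)%N -> open_simplex p ->
  (\sum_j tnth k j <= n)%N ->
  ln (multinomial_pmf n p k)
    + (d%:R * (ln (2 * pi) + ln n%:R) + \sum_i ln (all_probs p i)) / 2
  <= \sum_i (stirling_excess (all_counts n k i) (n%:R * all_probs p i)
      - ((all_counts n k i)%:R - n%:R * all_probs p i) ^+ 2 / (2 * (n%:R * all_probs p i))).
Proof.
move=> n0 op kn; rewrite /multinomial_pmf kn.
set q := all_probs p; set K := all_counts n k.
have q0 i : 0 < q i by exact: all_probs_gt0.
have nR : 0 < n%:R :> R by rewrite ltr0n.
have f0 m : 0 < m`!%:R :> R by rewrite ltr0n fact_gt0.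
have K1 : \sum_i (K i)%:R = n%:R :> R by rewrite -natr_sum sum_all_counts.
have q1 : \sum_i q i = 1 by exact: sum_all_probs.
rewrite [ln (_ / _ * _)]lnM ?posrE ?divr_gt0 ?prodr_gt0//; last by move=> i _; rewrite exprn_gt0.
rewrite ln_div ?posrE ?prodr_gt0// !ln_prodr//; last by move=> i; rewrite exprn_gt0.
under [X in _ + X + _]eq_bigr do rewrite lnXn// -mulr_natl.
have hn : ln n`!%:R = stirling_rem n + (n%:R + 2^-1) * ln n%:R - n%:R :> R.
  by rewrite /stirling_rem; lra.
have hs := @stirling_rem_lb R n n0.
set s := stirling_rem n in hn hs.
pose A i : R := - ((K i)%:R * ln (K i)%:R) + (K i)%:R * ln (n%:R * q i)
  + (ln (n%:R * q i) - ln (K i).+1%:R) / 2 + (K i).+1%:R^-1.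
apply: (@le_trans _ _ (\sum_i A i)); last first.
  have -> : \sum_i (stirling_excess (K i) (n%:R * q i)
        - ((K i)%:R - n%:R * q i) ^+ 2 / (2 * (n%:R * q i)))
     = \sum_i (stirling_excess (K i) (n%:R * q i) - ((K i)%:R - n%:R * q i)
        - ((K i)%:R - n%:R * q i) ^+ 2 / (2 * (n%:R * q i))).
    rewrite [RHS]sumrB [in RHS]sumrB [X in _ = _ - X - _](_ : _ = 0).
      by rewrite subr0 sumrB.
    by rewrite sumrB K1 -mulr_sumr q1 mulr1 subrr.
  by apply: ler_sum => i _; apply: stirling_term_le; rewrite mulr_gt0.
have hK i : - ln (K i)`!%:R <= - ((K i)%:R * ln (K i)%:R) + (K i)%:R
    - ln (K i).+1%:R / 2 + (K i).+1%:R^-1 - s.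
  have := @ln_fact_ge R (K i) n n0 (all_counts_le i kn); rewrite -/s.
  set a := _ * ln _; set b := ln _`!%:R; set c := ln _.
  set e := (K i).+1%:R^-1; set f := (K i)%:R.
  by clearbody a b c e f; lra.
have hsum : - (\sum_i ln (K i)`!%:R) <= \sum_i (- ((K i)%:R * ln (K i)%:R) + (K i)%:R
    - ln (K i).+1%:R / 2 + (K i).+1%:R^-1 - s).
  by rewrite -sumrN; apply: ler_sum.
have AE : \sum_i A i = \sum_i (- ((K i)%:R * ln (K i)%:R) + (K i)%:R
    - ln (K i).+1%:R / 2 + (K i).+1%:R^-1 - s) + \sum_i (K i)%:R * ln (q i)
    + (\sum_i ln (q i)) / 2 + (n%:R + d.+1%:R / 2) * ln n%:R - n%:R + d.+1%:R * s.
  have ass a b c e f g : a + b + c + e - f + g = a + b + c + (e - f + g) :> R by ring.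
  rewrite [RHS]ass [X in _ = _ + X](_ : _ =
      \sum_i (((K i)%:R + 2^-1) * ln n%:R - (K i)%:R + s)); last first.
    rewrite big_split/= sumrB -mulr_suml big_split/= K1 !sumr_const card_ord.
    by rewrite -[2^-1 *+ _]mulr_natl -[s *+ _]mulr_natl.
  rewrite mulr_suml -!big_split/=; apply: eq_bigr => i _; rewrite /A lnM ?posrE//.
  by field; rewrite gt_eqF// ltr0Sn.
rewrite AE hn -[d.+1%:R]natr1.
have : d%:R * (ln (2 * pi) / 2) <= d%:R * s :> R by rewrite ler_wpM2l.
move: hsum; set a := \sum_i (- _ + _ - _ + _ - _); set b := \sum_i ln _`!%:R.
set c := \sum_i _ * ln _; set e := \sum_i ln (q i); set l := ln n%:R; set l2 := ln (2 * pi).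
set D : R := d%:R; set N : R := n%:R.
by clearbody a b c e l l2 D N s; lra.
Qed.

End log_likelihood.

Section expected_excess.
Context {R : realType} {d : nat}.
Implicit Types (p : 'rV[R]_d) (n : nat).

(** With m = n p_i, the cubic has mean (1 - p)(1 - 2p) / (6 m) <= 1 / (6 m), and the mean
    of 1/(K+1) is at most 1/m, which makes the second term nonpositive in mean and
    the third at most 1/m. *)
Lemma expected_stirling_excess n p i : (0 < n)%N -> open_simplex p ->
  \sum_(w : d.-tuple 'I_n.+1) multinomial_pmf n p (counts_of w) *
    stirling_excess (all_counts n (counts_of w) i) (n%:R * all_probs p i)
  <= 7 / 6 / (n%:R * all_probs p i).
Proof.
move=> n0 op.
rewrite (multinomial_marginal n i (fun j => stirling_excess j (n%:R * all_probs p i)) op).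
set q := all_probs p i; have q0 : 0 < q by exact: all_probs_gt0.
have q1 : q <= 1.
  rewrite -(sum_all_probs p) (bigD1 i)//= lerDl sumr_ge0// => j _.
  by rewrite ltW// all_probs_gt0.
have nR : 0 < n%:R :> R by rewrite ltr0n.
have m0 : 0 < n%:R * q by rewrite mulr_gt0.
have mass0 j : 0 <= binomial_mass n q j.
  by rewrite /binomial_mass !mulr_ge0// exprn_ge0// ?subr_ge0// ltW.
set m := n%:R * q.
have -> : \sum_(j < n.+1) binomial_mass n q j * stirling_excess j m =
   (\sum_(j < n.+1) binomial_mass n q j * (j%:R - n%:R * q) ^+ 3) / (6 * m ^+ 2)
   + (m / 2 + 1) * (\sum_(j < n.+1) binomial_mass n q j * j.+1%:R^-1)
   - (\sum_(j < n.+1) binomial_mass n q j * 1) / 2.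
  rewrite !mulr_suml mulr_sumr -!sumrN -!big_split/=; apply: eq_bigr => j _.
  by rewrite /stirling_excess -/m; set x := j.+1%:R^-1; field; rewrite gt_eqF.
rewrite binomial_central_moment3 binomial_sum1 -/m.
have inv : \sum_(j < n.+1) binomial_mass n q j * j.+1%:R^-1 <= m^-1.
  (* [q < 1] can fail only for d = 0, where the count is almost surely n *)
  have [q1'|q1'] := ltP q 1.
    apply: le_trans (binomial_inv_succ n _) _; first by rewrite q0.
    by rewrite lef_pV2 ?posrE ?mulr_gt0// ler_pM2r// ler_nat.
  have -> : m = n%:R by rewrite /m (@le_anti _ _ q 1) ?mulr1 ?q1.
  have qE : q = 1 by apply/le_anti/andP.
  rewrite big_ord_recr/= big1 ?add0r; last first.
    by move=> j _; rewrite /binomial_mass qE subrr expr0n subn_eq0 leqNgt ltn_ord mulr0 mul0r.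
  rewrite /binomial_mass qE subnn binn expr1n expr0 !mul1r.
  by rewrite lef_pV2 ?posrE// ler_nat.
have m1 : 0 < m := m0.
have h : (m / 2 + 1) * (\sum_(j < n.+1) binomial_mass n q j * j.+1%:R^-1) <= (m / 2 + 1) * m^-1.
  by rewrite ler_wpM2l// addr_ge0// divr_ge0// ltW.
apply: (@le_trans _ _ (m * (1 - q) * (1 - 2 * q) / (6 * m ^+ 2) + (m / 2 + 1) * m^-1 - 1 / 2)).
  by rewrite lerD2r lerD2l.
have -> : m * (1 - q) * (1 - 2 * q) / (6 * m ^+ 2) + (m / 2 + 1) * m^-1 - 1 / 2
  = ((1 - q) * (1 - 2 * q) / 6 + 1) / m by field; rewrite gt_eqF.
rewrite ler_pM2r ?invr_gt0//; nra.
Qed.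

End expected_excess.

(** * The normal density and its total mass *)

Section zero_sum_extension.
Context {R : realType} {d : nat}.

(** The deviation of the last category is determined by the others, since all d + 1
    deviations sum to 0. *)
Definition zero_sum_ext (y : 'I_d -> R) : 'I_d.+1 -> R := fun i =>
  if unlift ord_max i is Some j then y j else - \sum_j y j.

Lemma sum_zero_sum_ext (y : 'I_d -> R) (F : 'I_d.+1 -> R -> R) :
  \sum_i F i (zero_sum_ext y i) =
  \sum_j F (lift ord_max j) (y j) + F ord_max (- \sum_j y j).
Proof.
rewrite (bigD1_ord ord_max)//= addrC /zero_sum_ext unlift_none.
by congr +%R; apply: eq_bigr => j _; rewrite liftK.
Qed.

End zero_sum_extension.

Section multinomial_covariance.
Context {R : realType} {d : nat}.
Implicit Types p : 'rV[R]_d.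

Lemma all_probs_lift p j : all_probs p (lift ord_max j) = p 0 j.
Proof. by rewrite /all_probs liftK. Qed.

Lemma all_probs_max p : all_probs p ord_max = 1 - \sum_j p 0 j.
Proof. by rewrite /all_probs unlift_none. Qed.

Lemma prod_all_probs p :
  \prod_i all_probs p i = (\prod_j p 0 j) * (1 - \sum_j p 0 j).
Proof.
rewrite (bigD1_ord ord_max)//= mulrC all_probs_max.
by congr *%R; apply: eq_bigr => j _; rewrite all_probs_lift.
Qed.

(** Both sides are the determinant of the block matrix with rows (1, u) and (v, 1),
    eliminated from either corner. *)
Lemma det_1B_mul (u : 'cV[R]_d) (v : 'rV[R]_d) :
  \det (1%:M - u *m v) = 1 - (v *m u) 0 0.
Proof.
have e : block_mx 1%:M 0 v 1%:M *m block_mx 1%:M u 0 (1%:M - v *m u) =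
    block_mx (1%:M - u *m v) u 0 1%:M *m block_mx 1%:M 0 v (1%:M : 'M[R]_1).
  rewrite !mulmx_block !mul1mx !mulmx1 !mul0mx !mulmx0 !addr0 !add0r.
  by rewrite subrK addrC subrK.
have := congr1 determinant e.
rewrite !det_mulmx !det_ublock !det_lblock !det1 !mul1r !mulr1 => <-.
by rewrite det_mx11 !mxE eqxx.
Qed.

(** The covariance is diag(p) (I - e p), where e is the column of ones. *)
Lemma det_multinomial_cov p : \det (multinomial_cov p) = \prod_i all_probs p i.
Proof.
rewrite prod_all_probs.
have -> : multinomial_cov p = diag_mx p *m (1%:M - const_mx 1 *m p).
  rewrite mulmxBr mulmx1 /multinomial_cov mulmxA; congr (_ - _ *m _).
  by apply/matrixP => i j; rewrite mul_diag_mx !mxE mulr1 ord1.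
rewrite det_mulmx det_diag det_1B_mul; congr (_ * (1 - _)).
by rewrite mxE; apply: eq_bigr => j _; rewrite mxE mulr1.
Qed.

(** The Sherman-Morrison formula for the rank-one perturbation of diag(p). *)
Lemma invmx_scale_multinomial_cov p (c : R) : c != 0 -> open_simplex p ->
  invmx (c *: multinomial_cov p) =
  \matrix_(i, j) (((i == j)%:R / p 0 i + (1 - \sum_k p 0 k)^-1) / c).
Proof.
move=> c0 op; set M := \matrix_(i, j) _.
have p0 j : p 0 j != 0.
  by rewrite -all_probs_lift gt_eqF// all_probs_gt0.
have q0 : 1 - \sum_k p 0 k != 0 by rewrite -all_probs_max gt_eqF// all_probs_gt0.
suff e : (c *: multinomial_cov p) *m M = 1%:M.
  by have [u _] := mulmx1_unit e; rewrite -[LHS]mulmx1 -e mulKmx.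
apply/matrixP => i j; rewrite !mxE.
have sE : \sum_k p 0 k * ((k == j)%:R / p 0 k + (1 - \sum_k p 0 k)^-1)
    = (1 - \sum_k p 0 k)^-1.
  under eq_bigr do rewrite mulrDr; rewrite big_split/= -mulr_suml.
  rewrite (bigD1 j)//= eqxx mul1r divff// big1 ?addr0; last first.
    by move=> k /negPf ->; rewrite mul0r mulr0.
  by field.
transitivity (\sum_k (((i == k)%:R * p 0 i)
     * ((k == j)%:R / p 0 k + (1 - \sum_k p 0 k)^-1)
   - p 0 i * (p 0 k * ((k == j)%:R / p 0 k + (1 - \sum_k p 0 k)^-1)))).
  apply: eq_bigr => k _; rewrite !mxE big_ord1 !mxE.
  by have [->|_] := eqVneq i k; rewrite ?mulr1n ?mulr0n; field; rewrite ?p0 ?c0 ?q0.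
rewrite sumrB -mulr_sumr sE (bigD1 i)//= eqxx mul1r.
rewrite [X in _ + X - _]big1 ?addr0; last first.
  by move=> k /negPf; rewrite eq_sym => ->; rewrite !mul0r.
by rewrite mulrDr addrK mulrCA divff ?mulr1.
Qed.

Lemma multinomial_mvnormal_pdfE (n : nat) p (x : Rn R d) : (0 < n)%N -> open_simplex p ->
  mvnormal_pdf (n%:R *: p) (n%:R *: multinomial_cov p) x =
  expR (- (\sum_i zero_sum_ext (fun j => tnth x j - n%:R * p 0 j) i ^+ 2
            / (n%:R * all_probs p i)) / 2)
  / Num.sqrt ((2 * pi * n%:R) ^+ d * \prod_i all_probs p i).
Proof.
move=> n0 op; have nR : n%:R != 0 :> R by rewrite pnatr_eq0 -lt0n.
rewrite /mvnormal_pdf detZ det_multinomial_cov mulrA -exprMn.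
rewrite invmx_scale_multinomial_cov//; congr (_ / _); congr expR; congr (- _ / _).
rewrite (sum_zero_sum_ext _ (fun i z => z ^+ 2 / (n%:R * all_probs p i))) all_probs_max.
set y := row_of_tuple x - _.
have yE j : y 0 j = tnth x j - n%:R * p 0 j by rewrite !mxE.
under [X in _ = X + _]eq_bigr do rewrite all_probs_lift -yE.
under [X in _ = _ + (- X) ^+ 2 / _]eq_bigr do rewrite -yE.
have p0 j : p 0 j != 0 by rewrite -all_probs_lift gt_eqF// all_probs_gt0.
have q0 : 1 - \sum_k p 0 k != 0 by rewrite -all_probs_max gt_eqF// all_probs_gt0.
set q := 1 - _ in q0 *.
have yM j : (y *m \matrix_(i, j) (((i == j)%:R / p 0 i + q^-1) / n%:R)) 0 j
    = (y 0 j / p 0 j + (\sum_k y 0 k) / q) / n%:R.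
  rewrite mxE mulr_suml.
  transitivity (\sum_i ((y 0 i * ((i == j)%:R / p 0 i)) + y 0 i / q) / n%:R).
    by apply: eq_bigr => i _; rewrite [X in _ * X]mxE; ring.
  rewrite -mulr_suml big_split/=; congr ((_ + _) / _).
  rewrite (bigD1 j)//= eqxx mul1r big1 ?addr0// => i /negPf ->.
  by rewrite mul0r mulr0.
rewrite mxE; transitivity (\sum_j (y 0 j ^+ 2 / (n%:R * p 0 j) + (\sum_k y 0 k) / (q * n%:R) * y 0 j)).
  by apply: eq_bigr => j _; rewrite yM [y^T _ _]mxE; field; rewrite nR p0 q0.
by rewrite big_split/= -mulr_sumr; congr (_ + _); field; rewrite q0.
Qed.

End multinomial_covariance.

Section power_measure_integral.
Context {dT : measure_display} {T : measurableType dT} {R : realType}.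
Variable mu : {sigma_finite_measure set T -> \bar R}.
Local Open Scope ereal_scope.

Lemma integral_power_measureS n (f : n.+1.-tuple T -> \bar R) :
  measurable_fun setT f -> (forall t, 0 <= f t) ->
  \int[power_measure mu n.+1]_t f t =
  \int[mu]_x \int[power_measure mu n]_t f (tcons (x, t)).
Proof.
move=> mf f0.
transitivity (\int[(mu \x power_measure mu n)%E]_z (f \o @tcons _ _ n) z).
  rewrite -[setT in RHS](preimage_setT (@tcons _ _ n)).
  rewrite -(@ge0_integral_pushforward _ _ _ _ _ (@tcons _ _ n))//.
  exact: measurable_tcons.
rewrite fubini_tonelli1//; last by move=> z; exact: f0.
by apply: measurableT_comp => //; exact: measurable_tcons.
Qed.

End power_measure_integral.

Section gaussian_mass.
Context {R : realType}.
Local Notation mu := (@lebesgue_measure R).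

(** The convolution of two centred Gaussian densities is Gaussian: completing the square
    in x leaves a normal density of variance a b / (a + b). *)
Lemma integral_gaussian_conv (a b m s : R) : 0 < a -> 0 < b ->
  (\int[mu]_x (expR (- ((x - m) ^+ 2 / a + (x - m + s) ^+ 2 / b) / 2))%:E =
  (Num.sqrt (2 * pi * (a * b / (a + b))) * expR (- (s ^+ 2 / (a + b)) / 2))%:E)%E.
Proof.
move=> a0 b0; have ab0 : 0 < a + b by rewrite addr_gt0.
set v := a * b / (a + b); have v0 : 0 < v by rewrite divr_gt0// mulr_gt0.
pose sg := Num.sqrt v; have sg0 : 0 < sg by rewrite sqrtr_gt0.
have sg2 : sg ^+ 2 = v by rewrite sqr_sqrtr// ltW.
pose m' := m - s * a / (a + b).
have := @integral_normal_pdf R m' sg.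
rewrite normal_pdfE ?gt_eqF// => e.
pose C := Num.sqrt (2 * pi * v) * expR (- (s ^+ 2 / (a + b)) / 2).
have p0 : 0 < 2 * pi * v by rewrite mulr_gt0// mulr_gt0// pi_gt0.
rewrite -/C -[RHS]mule1 -e -ge0_integralZl//=; last 3 first.
- apply/measurable_EFinP; rewrite -normal_pdfE ?gt_eqF//; exact: measurable_normal_pdf.
- by move=> x _; rewrite lee_fin mulr_ge0 ?normal_fun_ge0// normal_peak_ge0.
- by rewrite lee_fin mulr_ge0// ?expR_ge0.
apply: eq_integral => x _; rewrite -EFinM; congr EFin.
rewrite /normal_peak /normal_fun sg2.
have -> : v * pi *+ 2 = 2 * pi * v by rewrite -mulr_natl; ring.
rewrite /C [X in _ = X * _]mulrC -[RHS]mulrA mulVKf; last by rewrite gt_eqF// sqrtr_gt0.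
rewrite -expRD.
congr expR; rewrite /m' /v; field.
by rewrite !gt_eqF//.
Qed.

Lemma measurable_gaussian_zero_sum d (a m : 'I_d -> R) (b s : R) :
  measurable_fun [set: Rn R d] (fun x : Rn R d =>
    (expR (- (\sum_i (tnth x i - m i) ^+ 2 / a i
              + (\sum_i (tnth x i - m i) + s) ^+ 2 / b) / 2))%:E).
Proof.
have mt i : measurable_fun [set: Rn R d] (fun x : Rn R d => tnth x i - m i).
  by apply: measurable_funB => //; exact: measurable_tnth.
apply/measurable_EFinP; apply: measurableT_comp => //; apply: measurable_funM => //.
apply: measurable_funN; apply: measurable_funD.
  by apply: measurable_sum => i; apply: measurable_funM => //; exact: measurable_funX.
apply: measurable_funM => //; apply: measurable_funX; apply: measurable_funD => //.
exact: measurable_sum.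
Qed.

(** The parameter s makes the induction on d work: integrating out all coordinates but
    the first yields the same kind of integrand in one variable, with b
    enlarged by the remaining a_i. *)
Lemma integral_gaussian_zero_sum d (a m : 'I_d -> R) (b s : R) :
  (forall i, 0 < a i) -> 0 < b ->
  (\int[power_measure mu d]_x
    (expR (- (\sum_i (tnth x i - m i) ^+ 2 / a i
              + (\sum_i (tnth x i - m i) + s) ^+ 2 / b) / 2))%:E =
  (Num.sqrt ((2 * pi) ^+ d * \prod_i a i * b / (b + \sum_i a i))
    * expR (- (s ^+ 2 / (b + \sum_i a i)) / 2))%:E)%E.
Proof.
elim: d a m b s => [|d IH] a m b s a0 b0.
  rewrite integral_dirac//; last exact: measurable_gaussian_zero_sum.
  rewrite /= diracT mul1e !big_ord0 !add0r addr0 expr0 !mul1r.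
  by rewrite divff ?gt_eqF// sqrtr1 mul1r.
rewrite integral_power_measureS; last 2 first.
- exact: measurable_gaussian_zero_sum.
- by move=> t; rewrite lee_fin expR_ge0.
pose a' i := a (lift ord0 i); pose m' i := m (lift ord0 i).
pose b' := b + \sum_i a' i.
have b'0 : 0 < b' by rewrite ltr_pwDl// sumr_ge0// => i _; exact/ltW/a0.
have P0 : 0 < (2 * pi) ^+ d * \prod_i a' i * b / b' :> R.
  rewrite divr_gt0// mulr_gt0// mulr_gt0//; first by rewrite exprn_gt0// mulr_gt0// pi_gt0.
  by apply: prodr_gt0 => i _; exact: a0.
transitivity (\int[mu]_x ((Num.sqrt ((2 * pi) ^+ d * \prod_i a' i * b / b'))%:E *
    (expR (- ((x - m ord0) ^+ 2 / a ord0 + (x - m ord0 + s) ^+ 2 / b') / 2))%:E))%E.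
  apply: eq_integral => x _.
  transitivity (\int[power_measure mu d]_t ((expR (- ((x - m ord0) ^+ 2 / a ord0) / 2))%:E *
    (expR (- (\sum_i (tnth t i - m' i) ^+ 2 / a' i
              + (\sum_i (tnth t i - m' i) + (x - m ord0 + s)) ^+ 2 / b) / 2))%:E))%E.
    apply: eq_integral => t _; rewrite -EFinM -expRD; congr (expR _)%:E.
    rewrite !big_ord_recl/=.
    have e0 : tnth (tcons (x, t)) ord0 = x by [].
    have eS i : tnth (tcons (x, t)) (lift ord0 i) = tnth t i by rewrite /tcons tnthS.
    rewrite e0.
    have -> : \sum_(i < d) (tnth (tcons (x, t)) (lift ord0 i) - m (lift ord0 i)) ^+ 2
          / a (lift ord0 i)
      = \sum_(i < d) (tnth t i - m' i) ^+ 2 / a' i by apply: eq_bigr => i _; rewrite eS.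
    have -> : \sum_(i < d) (tnth (tcons (x, t)) (lift ord0 i) - m (lift ord0 i))
      = \sum_(i < d) (tnth t i - m' i) by apply: eq_bigr => i _; rewrite eS.
    set A := \sum_(i < d) (_ / _); set B := \sum_(i < d) (tnth t i - _).
    have -> : x - m ord0 + B + s = B + (x - m ord0 + s) by ring.
    by field; rewrite !gt_eqF.
  rewrite ge0_integralZl; last 4 first.
  - by [].
  - exact: measurable_gaussian_zero_sum.
  - by move=> t _; rewrite lee_fin expR_ge0.
  - by rewrite lee_fin expR_ge0.
  rewrite IH//; last by move=> i; exact: a0.
  rewrite -!EFinM -/b' mulrCA -expRD; congr (_ * expR _)%:E.
  by rewrite opprD mulrDl.
rewrite ge0_integralZl; [|by []| | |]; last 3 first.
- apply/measurable_EFinP; apply: measurableT_comp => //; apply: measurable_funM => //.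
  apply: measurable_funN; apply: measurable_funD; apply: measurable_funM => //.
    by apply: measurable_funX; apply: measurable_funB.
  by apply: measurable_funX; apply: measurable_funD => //; apply: measurable_funB.
- by move=> t _; rewrite lee_fin expR_ge0.
- by rewrite lee_fin sqrtr_ge0.
rewrite (integral_gaussian_conv _ _ (a0 ord0) b'0) -EFinM; congr EFin.
rewrite [LHS]mulrA -sqrtrM; last exact: ltW P0.
have bE : b + \sum_i a i = a ord0 + b' by rewrite big_ord_recl addrCA.
rewrite bE; congr (Num.sqrt _ * _).
rewrite big_ord_recl exprS -/a'; field.
by rewrite !gt_eqF// addr_gt0.
Qed.

Lemma mvnormal_prob_setT d (n : nat) (p : 'rV[R]_d) : (0 < n)%N -> open_simplex p ->
  mvnormal_prob (n%:R *: p) (n%:R *: multinomial_cov p) setT = 1%E.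
Proof.
move=> n0 op; have nR : 0 < n%:R :> R by rewrite ltr0n.
rewrite /mvnormal_prob; under eq_integral do rewrite multinomial_mvnormal_pdfE//.
have q0 : 0 < 1 - \sum_j p 0 j by rewrite -all_probs_max all_probs_gt0.
have p0 j : 0 < p 0 j by rewrite -all_probs_lift all_probs_gt0.
have D0 : 0 < (2 * pi * n%:R) ^+ d * \prod_i all_probs p i.
  rewrite mulr_gt0 ?exprn_gt0 ?mulr_gt0 ?pi_gt0//.
  by rewrite prodr_gt0// => i _; rewrite all_probs_gt0.
(* the a_i and b sum to n, which accounts for the factor n^d in the determinant *)
have := @integral_gaussian_zero_sum d (fun j => n%:R * p 0 j) (fun j => n%:R * p 0 j)
  (n%:R * (1 - \sum_j p 0 j)) 0 (fun i => mulr_gt0 nR (p0 i)) (mulr_gt0 nR q0).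
have -> : n%:R * (1 - \sum_j p 0 j) + \sum_i n%:R * p 0 i = n%:R.
  by rewrite -mulr_sumr -mulrDr subrK mulr1.
rewrite expr0n/= mul0r oppr0 mul0r expR0 mulr1 => e.
transitivity (\int[power_measure mu d]_x
  ((Num.sqrt ((2 * pi * n%:R) ^+ d * \prod_i all_probs p i))^-1%:E *
   (expR (- (\sum_i (tnth x i - n%:R * p 0 i) ^+ 2 / (n%:R * p 0 i)
              + (\sum_i (tnth x i - n%:R * p 0 i) + 0) ^+ 2
                / (n%:R * (1 - \sum_j p 0 j))) / 2))%:E))%E.
  apply: eq_integral => x _; rewrite -EFinM mulrC; congr EFin; congr (_ * _); congr expR; congr (- _ / _).
  rewrite (sum_zero_sum_ext _ (fun i z => z ^+ 2 / (n%:R * all_probs p i))) all_probs_max.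
  by rewrite addr0 sqrrN; under eq_bigr do rewrite all_probs_lift.
rewrite ge0_integralZl; last 4 first.
- by [].
- exact: measurable_gaussian_zero_sum.
- by move=> t _; rewrite lee_fin expR_ge0.
- by rewrite lee_fin invr_ge0.
rewrite e -EFinM; congr EFin.
set x := (X in _ * Num.sqrt X).
have -> : x = (2 * pi * n%:R) ^+ d * \prod_i all_probs p i.
  rewrite /x prod_all_probs big_split/= prodr_const card_ord [in RHS]exprMn; field.
  by rewrite gt_eqF.
by rewrite mulVf// gt_eqF// sqrtr_gt0.
Qed.

End gaussian_mass.

(** * Lattice cells and the jittered law *)

Section lattice_cells.
Context {R : realType}.
Local Notation mu := (@lebesgue_measure R).
Local Notation unif := (uniform_prob (@half_interval R)).
Local Open Scope ereal_scope.

Lemma measurable_shift (c : R) :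
  measurable_fun setT (fun x : measurableTypeR R => c + x : measurableTypeR R)%R.
Proof. exact: measurable_funD. Qed.

Lemma lebesgue_measure_shift (c : R) (A : set R) : measurable A ->
  pushforward mu (fun x : measurableTypeR R => c + x : measurableTypeR R)%R A = mu A.
Proof.
have mc := measurable_shift c.
move=> mA; apply/esym/lebesgue_measure_unique => //= _ [[a b]] _ <-.
rewrite /pushforward.
have -> : (fun x : R => c + x)%R @^-1` `]a, b]%classic = `](a - c)%R, (b - c)%R]%classic.
  by apply/seteqP; split => x /=; rewrite !in_itv/= ltrBlDl lerBrDl.
rewrite !lebesgue_measure_itv/= !lte_fin ltrD2r.
by rewrite -!EFinB; case: ifP => // _; congr EFin; ring.
Qed.

Lemma integral_unif_shift (f : measurableTypeR R -> \bar R) (c : R) :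
  measurable_fun setT f -> (forall x, 0 <= f x) ->
  \int[unif]_v f (c + v)%R = \int[mu]_(x in `[(c - 2^-1)%R, (c + 2^-1)%R[) f x.
Proof.
move=> mf f0.
have mc := measurable_shift c.
rewrite integral_uniform//; last exact: measurableT_comp mf mc.
have -> : (2^-1 - - 2^-1)^-1%R = 1%R :> R by rewrite (_ : 2^-1 - - 2^-1 = 1)%R ?invr1//; lra.
rewrite mul1e integral_itv_bndo_bndc; last exact: measurable_funTS.
have -> : `[(- 2^-1)%R, 2^-1%R]%classic =
   (fun x : R => c + x)%R @^-1` `[(c - 2^-1)%R, (c + 2^-1)%R]%classic.
  by apply/seteqP; split => x /=; rewrite !in_itv/= !lerD2l.
rewrite -(@ge0_integral_pushforward _ _ _ _ _
  (fun x : measurableTypeR R => c + x : measurableTypeR R)%R)//.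
- by apply: eq_measure_integral => A mA _; exact: lebesgue_measure_shift.
- exact: measurable_funTS.
Qed.

(** The half-open unit intervals centred at the integers are disjoint. *)
Lemma sum_unif_shift_le n (f : measurableTypeR R -> \bar R) :
  measurable_fun setT f -> (forall x, 0 <= f x) ->
  \sum_(j < n) \int[unif]_v f (j%:R + v)%R <= \int[mu]_x f x.
Proof.
move=> mf f0; under eq_bigr do rewrite integral_unif_shift//.
rewrite -(@ge0_integral_bigsetU _ _ _ mu _
  (fun j : 'I_n => `[((j : nat)%:R - 2^-1)%R, ((j : nat)%:R + 2^-1)%R[%classic))//.
- apply: ge0_subset_integral => //.
  by apply: bigsetU_measurable => j _.
- exact: index_enum_uniq.
- apply/trivIsetP => i j _ _ ij; apply/seteqP; split => // x /=.
  rewrite !in_itv/= => -[/andP[i1 i2] /andP[j1 j2]].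
  have : ((i : nat)%:R < (j.+1)%:R :> R)%R by rewrite -natr1; lra.
  have : ((j : nat)%:R < (i.+1)%:R :> R)%R by rewrite -natr1; lra.
  rewrite !ltr_nat !ltnS => h1 h2; move/eqP: ij; apply; apply/val_inj/eqP.
  by rewrite eqn_leq h1 h2.
- exact: measurable_funTS.
Qed.

Lemma jitter_tcons d (j : nat) (k : d.-tuple nat) (v : R) (u : Rn R d) :
  jitter (tcons (j, k), tcons (v, u)) = tcons (j%:R + v, jitter (k, u))%R :> Rn R d.+1.
Proof.
apply: eq_from_tnth => i; rewrite tnth_mktuple.
case: (unliftP ord0 i) => [i' ->|->]; last by [].
by rewrite /tcons !tnthS tnth_mktuple.
Qed.

Lemma counts_of_tcons d n (j : 'I_n.+1) (w : d.-tuple 'I_n.+1) :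
  counts_of [tuple of j :: w] = tcons (j : nat, counts_of w).
Proof. exact: val_inj. Qed.

Lemma sum_tupleS (I : finType) d (F : d.+1.-tuple I -> \bar R) :
  \sum_(w : d.+1.-tuple I) F w = \sum_(j : I) \sum_(w : d.-tuple I) F [tuple of j :: w].
Proof.
rewrite pair_big/= (reindex (fun jw : I * d.-tuple I => [tuple of jw.1 :: jw.2]))//=.
exists (fun w : d.+1.-tuple I => (thead w, [tuple of behead w])).
  by move=> [j w] _ /=; congr pair; exact: val_inj.
by move=> w _ /=; rewrite -tuple_eta.
Qed.

Lemma measurable_jitter_fixed d (k : d.-tuple nat) :
  measurable_fun [set: Rn R d] (fun u : Rn R d => jitter (k, u)).
Proof.
apply/measurable_fun_tnthP => i.
rewrite (_ : _ \o _ =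
  fun u : Rn R d => (tnth k i)%:R + tnth u i : measurableTypeR R)%R; last first.
  by apply/funext => u /=; rewrite tnth_mktuple.
by apply: measurable_funD => //; exact: measurable_tnth.
Qed.

(** The cells of side 1 around the lattice points are disjoint, one coordinate at a time:
    the induction peels off the first coordinate by Tonelli's theorem. *)
Lemma sum_uniform_cube_le d n (f : Rn R d -> \bar R) :
  measurable_fun setT f -> (forall x, 0 <= f x) ->
  \sum_(w : d.-tuple 'I_n.+1) \int[uniform_cube]_u f (jitter (counts_of w, u))
  <= \int[power_measure mu d]_x f x.
Proof.
elim: d f => [|d IH] f mf f0.
  rewrite (big_pred1 ([tuple] : 0.-tuple 'I_n.+1)); last by move=> w; apply/esym/eqP; exact: tuple0.
  rewrite /uniform_cube !integral_dirac//; last first.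
    by apply: measurableT_comp => //; exact: measurable_jitter_fixed.
  by rewrite !diracT !mul1e tuple0.
rewrite integral_power_measureS//.
have mfS (x : R) : measurable_fun [set: Rn R d] (fun t : Rn R d => f (tcons (x, t))).
  apply: (measurableT_comp (f := f) (g := fun t => tcons (x, t))) => //.
  have h1 := @measurable_pair1 _ _ (measurableTypeR R) (Rn R d) x.
  exact: (measurableT_comp (@measurable_tcons _ (measurableTypeR R) d) h1).
rewrite sum_tupleS.
have mF : measurable_fun setT (fun x : measurableTypeR R =>
    \int[power_measure mu d]_t f (tcons (x, t))).
  apply: (measurable_fun_fubini_tonelli_F (fun z => f (tcons z))) => //.
  by apply: measurableT_comp => //; exact: measurable_tcons.
apply: le_trans (sum_unif_shift_le n.+1 mF _); last first.
  by move=> x; apply: integral_ge0.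
apply: lee_sum => j _.
have mG (w : d.-tuple 'I_n.+1) : measurable_fun setT (fun v : measurableTypeR R =>
    \int[uniform_cube]_u f (tcons ((j : nat)%:R + v, jitter (counts_of w, u)))%R).
  apply: (measurable_fun_fubini_tonelli_F (fun z : measurableTypeR R * Rn R d =>
    f (tcons ((j : nat)%:R + z.1, jitter (counts_of w, z.2)))%R)) => //.
  have mz : measurable_fun setT (fun z : measurableTypeR R * Rn R d =>
      ((j : nat)%:R + z.1 : measurableTypeR R, jitter (counts_of w, z.2))%R).
    apply/measurable_fun_pair => /=; first by apply: measurable_funD.
    exact: (measurableT_comp (@measurable_jitter_fixed d (counts_of w)) measurable_snd).
  exact: (measurableT_comp mf (measurableT_comp (@measurable_tcons _ (measurableTypeR R) d) mz)).
under eq_bigr => w _.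
  rewrite /uniform_cube integral_power_measureS; last 2 first.
  - by apply: measurableT_comp => //; exact: measurable_jitter_fixed.
  - by move=> t; exact: f0.
  under eq_integral => v _.
    under eq_integral do rewrite counts_of_tcons jitter_tcons.
    over.
  over.
rewrite -ge0_integral_sum//; last by move=> w v _; exact: integral_ge0.
apply: ge0_le_integral => //.
- by move=> v _; apply: sume_ge0 => w _; exact: integral_ge0.
- by apply: emeasurable_sum => w; exact: mG.
- exact: (measurableT_comp mF (measurable_shift (j : nat)%:R)).
- by move=> v _; apply: (IH (fun t => f (tcons ((j : nat)%:R + v, t))%R)).
Qed.

End lattice_cells.

Section jittered_multinomial_law.
Context {R : realType} {d : nat}.
Variables (n : nat) (p : 'rV[R]_d).
Local Open Scope ereal_scope.

Lemma measurable_tuple_nat1 (k : d.-tuple nat) : measurable [set k].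
Proof.
have -> : [set k] = \bigcap_(i in [set: 'I_d])
    ((fun t : d.-tuple nat => tnth t i) @^-1` [set tnth k i]).
  apply/seteqP; split => [t -> //|t h]; apply: eq_from_tnth => i; exact: h.
apply: fin_bigcap_measurable => // i _.
by rewrite -[X in measurable X]setTI; exact: measurable_tnth.
Qed.

(** The law is carried by the finitely many atoms [counts_of w]; the rest is null. *)
Lemma integral_multinomial_prob (g : d.-tuple nat -> \bar R) : simplex p ->
  measurable_fun setT g -> (forall k, 0 <= g k) ->
  \int[multinomial_prob n p]_k g k =
  \sum_(w : d.-tuple 'I_n.+1) (multinomial_pmf n p (counts_of w))%:E * g (counts_of w).
Proof.
move=> sp mg g0.
pose D (w : d.-tuple 'I_n.+1) := [set counts_of w].
pose B := \big[setU/set0]_(w : d.-tuple 'I_n.+1) D w.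
have mD w : measurable (D w) by exact: measurable_tuple_nat1.
have mB : measurable B by exact: bigsetU_measurable.
have BC : multinomial_prob n p (~` B) = 0.
  rewrite /multinomial_prob ifT ?inE//; apply: esum1 => k Bk.
  rewrite /multinomial_pmf ifF//; apply/negP => kn; apply: Bk.
  have [w wk] := counts_of_surj kn.
  by rewrite /B -bigcup_seq; exists w => //=; rewrite ?mem_index_enum.
rewrite -(setUv B) ge0_integral_setU//; last 3 first.
- exact: measurableC.
- by rewrite setUv.
- by rewrite disj_set2E setICr.
rewrite [X in _ + X](_ : _ = 0) ?adde0; last first.
  apply: null_set_integral => //; [exact: measurableC|exact: measurable_funTS].
rewrite ge0_integral_bigsetU//; last 3 first.
- exact: index_enum_uniq.
- apply/trivIsetP => u v _ _ uv; apply/seteqP; split => // k [/= -> /counts_of_inj].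
  by move/eqP: uv.
- exact: measurable_funTS.
apply: eq_bigr => w _; rewrite (eq_integral (cst (g (counts_of w)))); last first.
  by move=> k; rewrite inE => ->.
rewrite integral_cst// muleC; congr *%E.
transitivity (multinomial_prob n p [set counts_of w]) => //.
by rewrite /multinomial_prob ifT ?inE// esum_set1// lee_fin multinomial_pmf_ge0.
Qed.

Lemma jittered_multinomialE (A : set (Rn R d)) : simplex p -> measurable A ->
  jittered_multinomial n p A =
  \sum_(w : d.-tuple 'I_n.+1) (multinomial_pmf n p (counts_of w))%:E *
     \int[uniform_cube]_u (\1_A (jitter (counts_of w, u)))%:E.
Proof.
move=> sp mA; rewrite /jittered_multinomial /distribution /pushforward.
have mJ : measurable (@jitter R d @^-1` A).
  by rewrite -[X in measurable X]setTI; exact: measurable_funPT.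
transitivity (\int[multinomial_prob n p]_k uniform_cube (xsection (@jitter R d @^-1` A) k)) => //.
rewrite integral_multinomial_prob//; last exact: (measurable_fun_xsection uniform_cube mJ).
apply: eq_bigr => w _; congr *%E.
have mx : measurable (xsection (@jitter R d @^-1` A) (counts_of w)) by exact: measurable_xsection.
transitivity (\int[uniform_cube]_u (\1_(xsection (@jitter R d @^-1` A) (counts_of w)) u)%:E).
  by rewrite integral_indic// setIT.
apply: eq_integral => u _.
by rewrite !indicE mem_xsection; congr (_%:R%:E); rewrite !inE.
Qed.

End jittered_multinomial_law.

(** * Moments of the uniform jitter *)

Section uniform_moments.
Context {R : realType}.
Local Notation mu := (@lebesgue_measure R).
Local Notation unif := (uniform_prob (@half_interval R)).
Local Open Scope ereal_scope.

Lemma integral_unifN (f : measurableTypeR R -> \bar R) :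
  measurable_fun setT f -> (forall x, 0 <= f x) ->
  \int[unif]_v f (- v)%R = \int[unif]_v f v.
Proof.
move=> mf f0.
have mN : measurable_fun setT (fun x : measurableTypeR R => - x : measurableTypeR R)%R.
  exact: oppr_measurable.
rewrite !integral_uniform//; last exact: (measurableT_comp mf mN).
congr *%E.
have E : `[(- 2^-1)%R, 2^-1%R]%classic =
   (fun x : R => - x)%R @^-1` `[(- 2^-1)%R, 2^-1%R]%classic.
  apply/seteqP; split => x /=; rewrite !in_itv/= => /andP[? ?];
    by apply/andP; split; lra.
rewrite [in LHS]E.
rewrite -(@ge0_integral_pushforward _ _ _ _ _
  (fun x : measurableTypeR R => - x : measurableTypeR R)%R)//.
- by apply: eq_measure_integral => A mA _; exact: lebesgue_measureN.
- exact: measurable_funTS.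
Qed.

Lemma integral_unif_le (f : measurableTypeR R -> \bar R) (c : R) : (0 <= c)%R ->
  measurable_fun setT f -> (forall x, 0 <= f x) ->
  (forall x, (`|x| <= 2^-1)%R -> f x <= c%:E) -> \int[unif]_v f v <= c%:E.
Proof.
move=> c0 mf f0 fc; rewrite integral_uniform//.
have -> : (2^-1 - - 2^-1)^-1%R = 1%R :> R by rewrite (_ : 2^-1 - - 2^-1 = 1)%R ?invr1//; lra.
rewrite mul1e; apply: (@le_trans _ _ (\int[mu]_(x in `[(- 2^-1)%R, 2^-1%R]) c%:E)).
  apply: ge0_le_integral => //; first exact: measurable_funTS.
  by move=> x; rewrite /= in_itv/= => /andP[x1 x2]; apply: fc; rewrite ler_norml x1.
rewrite integral_cst//= lebesgue_measure_itv/= lte_fin half_interval -EFinB -EFinM lee_fin.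
by rewrite (_ : 2^-1 - - 2^-1 = 1)%R ?mulr1//; lra.
Qed.

Lemma integrable_unif_id : unif.-integrable setT (fun v : measurableTypeR R => v%:E).
Proof.
apply/integrableP; split; first exact/measurable_EFinP.
apply: (@le_lt_trans _ _ (2^-1)%:E); last by rewrite ltry.
by apply: integral_unif_le => //; exact: measurableT_comp.
Qed.

(** By symmetry the positive and the negative part have the same integral. *)
Lemma integral_unif_id : \int[unif]_v (v : R)%:E = 0.
Proof.
pose f (v : measurableTypeR R) := (v : R)%:E.
have mf : measurable_fun setT f by exact/measurable_EFinP.
rewrite integralE -[X in _ - X](_ : \int[unif]_v f^\+ v = _).
  by rewrite subee//; exact: (integrable_pos_fin_num measurableT integrable_unif_id).
rewrite -integral_unifN//; last exact: measurable_funepos.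
by apply: eq_integral => v _; rewrite funeposE funenegE /f EFinN.
Qed.

End uniform_moments.

Section coordinates.
Context {dT : measure_display} {T : measurableType dT} {R : realType}.
Variable mu : probability T R.
Local Open Scope ereal_scope.

Lemma power_measure_coordinate n (i : 'I_n) (A : set T) : measurable A ->
  pushforward (power_measure mu n) (fun t => tnth t i) A = mu A.
Proof.
move=> mA; elim: n i => [[]//|n IH] i.
transitivity ((mu \x power_measure mu n) ((@tcons _ _ n) @^-1` ((fun t => tnth t i) @^-1` A))) => //.
case: (unliftP ord0 i) => [i' ->|->].
  rewrite (_ : _ @^-1` _ = setT `*` ((fun t => tnth t i') @^-1` A)).
    rewrite product_measure1E//; last first.
      by rewrite -[X in measurable X]setTI; exact: measurable_tnth.
    rewrite [X in X * _](_ : _ = 1) ?mul1e; last exact: probability_setT.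
    exact: IH.
  by apply/seteqP; split => -[x t] /=; rewrite /tcons tnthS => // -[].
rewrite (_ : _ @^-1` _ = A `*` setT).
  rewrite product_measure1E// [X in _ * X](_ : _ = 1) ?mule1//.
  exact: (probability_setT (power_measure mu n)).
by apply/seteqP; split => -[x t] //= [].
Qed.

Lemma ge0_integral_coordinate n (i : 'I_n) (f : T -> \bar R) :
  measurable_fun setT f -> (forall x, 0 <= f x) ->
  \int[power_measure mu n]_t f (tnth t i) = \int[mu]_x f x.
Proof.
move=> mf f0; rewrite -(preimage_setT (fun t : n.-tuple T => tnth t i)).
rewrite -(ge0_integral_pushforward (measurable_tnth i))//.
apply: eq_measure_integral => [|mt A mA _]; first exact: measurable_tnth.
exact: power_measure_coordinate.
Qed.

Lemma integrable_coordinate n (i : 'I_n) (f : T -> \bar R) :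
  mu.-integrable setT f -> (power_measure mu n).-integrable setT (fun t => f (tnth t i)).
Proof.
move=> /integrableP[mf foo]; apply/integrableP; split.
  by apply: (measurableT_comp mf); exact: measurable_tnth.
rewrite (ge0_integral_coordinate i (f := fun x => `|f x|))//.
exact: measurableT_comp.
Qed.

Lemma integral_coordinate n (i : 'I_n) (f : T -> \bar R) :
  mu.-integrable setT f ->
  \int[power_measure mu n]_t f (tnth t i) = \int[mu]_x f x.
Proof.
move=> fi; have [mf _] := integrableP _ _ _ fi.
rewrite -(preimage_setT (fun t : n.-tuple T => tnth t i)).
rewrite -(integral_pushforward (measurable_tnth i))//.
- apply: eq_measure_integral => [|mt A mA _]; first exact: measurable_tnth.
  exact: power_measure_coordinate.
- by rewrite preimage_setT; exact: (integrable_coordinate i fi).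
Qed.

End coordinates.

Section uniform_cube_moments.
Context {R : realType} {d : nat}.
Local Notation unif := (uniform_prob (@half_interval R)).
Local Open Scope ereal_scope.

Lemma integrable_unif_sqr : unif.-integrable setT (fun v : measurableTypeR R => (v ^+ 2)%R%:E).
Proof.
apply/integrableP; split; first exact/measurable_EFinP/measurable_funX.
apply: (@le_lt_trans _ _ (4^-1)%:E); last by rewrite ltry.
apply: integral_unif_le => //.
  by apply: measurableT_comp => //; exact/measurable_EFinP/measurable_funX.
move=> x; rewrite ler_norml => /andP[x1 x2].
by rewrite /= lee_fin ger0_norm ?sqr_ge0//; nra.
Qed.

Lemma integral_unif_sqr_le : \int[unif]_v ((v : R) ^+ 2)%R%:E <= (4^-1)%:E.
Proof.
apply: integral_unif_le => //; first exact/measurable_EFinP/measurable_funX.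
  by move=> x; rewrite lee_fin sqr_ge0.
by move=> x; rewrite ler_norml => /andP[x1 x2]; rewrite lee_fin; nra.
Qed.

(** The shape of the bound for log (P(k) / q(k + u)) as a function of the jitter u. *)
Definition affine_sqr (C a : R) (c : 'I_d -> R) (u : Rn R d) : R :=
  (C + \sum_j c j * tnth u j + a * \sum_j tnth u j ^+ 2)%R.

Lemma integral_affine_sqr (C a : R) (c : 'I_d -> R) : (0 <= a)%R ->
  (uniform_cube (d := d)).-integrable setT (fun u => (affine_sqr C a c u)%:E) /\
  \int[uniform_cube]_u (affine_sqr C a c u)%:E <= (C + a * (d%:R / 4))%:E.
Proof.
move=> a0.
pose U : probability (Rn R d) R := uniform_cube.
have i1 j : U.-integrable setT (fun u => (tnth u j)%:E).
  exact: (integrable_coordinate j integrable_unif_id).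
have i2 j : U.-integrable setT (fun u => (tnth u j ^+ 2)%R%:E).
  exact: (integrable_coordinate j integrable_unif_sqr).
have iC : U.-integrable setT (fun u => C%:E).
  by apply: finite_measure_integrable_cst.
have I1 : U.-integrable setT (fun u => \sum_j (c j)%:E * (tnth u j)%:E).
  by apply: integrable_sum => // j _; apply: integrableZl.
have I2 : U.-integrable setT (fun u => a%:E * \sum_j (tnth u j ^+ 2)%R%:E).
  by apply: integrableZl => //; apply: integrable_sum.
have E : (fun u => (affine_sqr C a c u)%:E) = (fun u =>
   C%:E + \sum_j (c j)%:E * (tnth u j)%:E + a%:E * \sum_j (tnth u j ^+ 2)%R%:E).
  by apply/funext => u; rewrite /affine_sqr !EFinD EFinM -!sumEFin.
rewrite E; split.
  by apply: integrableD => //; apply: integrableD.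
rewrite integralD//; last by apply: integrableD.
rewrite integralD// integral_cst//= [X in C%:E * X]probability_setT mule1.
rewrite integral_sum//; last by move=> j; apply: integrableZl.
rewrite big1 ?adde0; last first.
  move=> j _; rewrite integralZl// (integral_coordinate j integrable_unif_id).
  by rewrite integral_unif_id mule0.
rewrite integralZl//; last by apply: integrable_sum.
rewrite integral_sum// EFinD EFinM leeD2l// lee_wpmul2l ?lee_fin//.
apply: (@le_trans _ _ (\sum_(j < d) (4^-1)%:E)).
  apply: lee_sum => j _; rewrite (integral_coordinate j integrable_unif_sqr).
  exact: integral_unif_sqr_le.
by rewrite sumEFin sumr_const card_ord lee_fin mulr_natl.
Qed.

End uniform_cube_moments.

(** * The likelihood ratio on a lattice cell *)

Section likelihood_ratio.
Context {R : realType}.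

(** This is log s <= s - 1 at s = sqrt r. *)
Lemma ln_ge_hellinger (r : R) : 0 < r -> (1 - Num.sqrt r) ^+ 2 <= r - 1 - ln r.
Proof.
move=> r0; set s := Num.sqrt r.
have s0 : 0 < s by rewrite sqrtr_gt0.
have sr : s ^+ 2 = r by rewrite sqr_sqrtr// ltW.
have : ln r <= 2 * (s - 1).
  have -> : ln r = 2 * ln s by rewrite -sr lnXn// mulr_natl.
  rewrite ler_pM2l//.
  by have := @le_ln1Dx R (s - 1); rewrite [1 + _]addrC subrK; apply; lra.
rewrite -{2}sr; lra.
Qed.

(** Put r = q/P and s = sqrt r.  If b holds, P - q = P (1 - s)(1 + s) is at most
    2 P (1 - s), hence at most P (e/2 + (2/e) (1 - s)^2), and (1 - s)^2 <= L - 1 + r by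
    [ln_ge_hellinger].  The terms other than q b therefore have a nonnegative sum,
    which is the inequality when b fails. *)
Lemma mass_le_density (P q L e : R) (b : bool) : 0 < P -> 0 < q -> 0 < e ->
  ln P - ln q <= L ->
  P * b%:R <= q * b%:R + 2 / e * q + (P * (e / 2) + 2 / e * (P * L - P)).
Proof.
move=> P0 q0 e0 hL.
have r0 : 0 < q / P by rewrite divr_gt0.
have := ln_ge_hellinger r0; rewrite ln_div ?posrE//.
set r := q / P in r0 *; set s := Num.sqrt r => hs.
have s0 : 0 <= s by rewrite sqrtr_ge0.
have sr : s ^+ 2 = r by rewrite sqr_sqrtr// ltW.
have qE : q = P * r by rewrite /r mulrC divfK// gt_eqF.
have hg : (1 - s) ^+ 2 <= L - 1 + r by lra.
have hg2 : (1 - s) ^+ 2 * (2 / e) <= (L - 1 + r) * (2 / e) by rewrite ler_wpM2r// divr_ge0// ltW.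
have key : b%:R <= r * b%:R + e / 2 + (1 - s) ^+ 2 * (2 / e).
  have amgm : 2 * (1 - s) <= e / 2 + (1 - s) ^+ 2 * (2 / e).
    rewrite -subr_ge0.
    have -> : e / 2 + (1 - s) ^+ 2 * (2 / e) - 2 * (1 - s) = (e - 2 * (1 - s)) ^+ 2 / (2 * e).
      by field; rewrite gt_eqF.
    by rewrite divr_ge0 ?sqr_ge0// mulr_ge0// ltW.
  have : 0 <= e / 2 + (1 - s) ^+ 2 * (2 / e).
    by apply: addr_ge0; [|apply: mulr_ge0 (sqr_ge0 _) _]; apply: divr_ge0 => //; exact: ltW.
  case: b => h0; rewrite ?mulr1 ?mulr0 ?add0r//.
  rewrite mulr1n -sr; move: amgm h0; set Y := _ * (2 / e) => amgm h0.
  have [s1|s1] := leP s 1; last by have : 1 <= s ^+ 2; [rewrite exprn_ege1// ltW|lra].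
  have : 1 - s ^+ 2 <= 2 * (1 - s) by nra.
  by lra.
have : P * b%:R <= P * (r * b%:R + e / 2 + (L - 1 + r) * (2 / e)).
  by rewrite ler_pM2l//; lra.
move=> h; apply: (le_trans h); rewrite qE le_eqVlt; apply/orP; left; apply/eqP; field.
by rewrite gt_eqF.
Qed.

(** Expand the product and use 2 y_i y_j <= y_i^2 + y_j^2. *)
Lemma sqr_sum_le d (y : 'I_d -> R) : (\sum_j y j) ^+ 2 <= d%:R * \sum_j y j ^+ 2.
Proof.
rewrite expr2 mulr_suml.
have -> : d%:R * \sum_j y j ^+ 2 = \sum_i \sum_j (y i ^+ 2 + y j ^+ 2) / 2.
  transitivity (\sum_(i < d) (d%:R * (y i ^+ 2 / 2) + \sum_j y j ^+ 2 / 2)).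
    rewrite big_split/= -mulr_sumr sumr_const card_ord -[X in _ + X]mulr_natl -mulr_suml.
    by rewrite -mulrDr; congr *%R; field.
  apply: eq_bigr => i _; under [RHS]eq_bigr do rewrite mulrDl.
  by rewrite big_split/= sumr_const card_ord -[X in _ = X + _]mulr_natl.
apply: ler_sum => i _; rewrite mulr_sumr; apply: ler_sum => j _.
have := sqr_ge0 (y i - y j); lra.
Qed.

End likelihood_ratio.

Section log_ratio.
Context {R : realType} {d : nat}.
Variables (n : nat) (p : 'rV[R]_d).
Hypotheses (n0 : (0 < n)%N) (op : open_simplex p).
Local Notation Q := (mvnormal_pdf (n%:R *: p) (n%:R *: multinomial_cov p)).
Local Notation m i := (n%:R * all_probs p i).

Lemma mvnormal_pdf_gt0 (x : Rn R d) : 0 < Q x.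
Proof.
rewrite multinomial_mvnormal_pdfE// divr_gt0 ?expR_gt0// sqrtr_gt0.
rewrite mulr_gt0 ?exprn_gt0 ?mulr_gt0 ?pi_gt0 ?ltr0n//.
by rewrite prodr_gt0// => i _; rewrite all_probs_gt0.
Qed.

Lemma zero_sum_ext_jitter (k : d.-tuple nat) (u : Rn R d) i :
  (\sum_j tnth k j <= n)%N ->
  zero_sum_ext (fun j => tnth (jitter (k, u)) j - n%:R * p 0 j) i =
  ((all_counts n k i)%:R - m i) + zero_sum_ext (tnth u) i.
Proof.
move=> kn; rewrite /zero_sum_ext /all_counts /all_probs.
case: unliftP => [j _|_]; first by rewrite tnth_mktuple/= addrAC.
have -> : \sum_j (tnth (jitter (k, u)) j - n%:R * p 0 j) =
    \sum_j (tnth k j)%:R + \sum_j tnth u j - n%:R * \sum_j p 0 j.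
  by rewrite mulr_sumr -big_split/= -sumrB; apply: eq_bigr => j _; rewrite tnth_mktuple.
by rewrite natrB// natr_sum; ring.
Qed.

Lemma ln_mvnormal_pdf (x : Rn R d) :
  ln (Q x) = - (\sum_i zero_sum_ext (fun j => tnth x j - n%:R * p 0 j) i ^+ 2 / m i) / 2
   - (d%:R * (ln (2 * pi) + ln n%:R) + \sum_i ln (all_probs p i)) / 2.
Proof.
have p0 := pi_gt0 R; have nR : 0 < n%:R :> R by rewrite ltr0n.
have q0 i : 0 < all_probs p i by exact: all_probs_gt0.
have D0 : 0 < (2 * pi * n%:R) ^+ d * \prod_i all_probs p i.
  by rewrite mulr_gt0 ?exprn_gt0 ?mulr_gt0//; exact: prodr_gt0.
rewrite multinomial_mvnormal_pdfE// ln_div ?posrE ?expR_gt0 ?sqrtr_gt0// expRK; congr (_ - _).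
have : ln (Num.sqrt ((2 * pi * n%:R) ^+ d * \prod_i all_probs p i) ^+ 2) =
  d%:R * (ln (2 * pi) + ln n%:R) + \sum_i ln (all_probs p i).
  rewrite sqr_sqrtr ?ltW// lnM ?posrE ?exprn_gt0 ?mulr_gt0 ?prodr_gt0//.
  rewrite lnXn ?mulr_gt0// ln_prodr// [ln (2 * pi * n%:R)]lnM ?posrE ?mulr_gt0//.
  by rewrite -[_ *+ d]mulr_natl.
rewrite lnXn ?sqrtr_gt0// -mulr_natl; lra.
Qed.

(** The coefficient of the j-th jitter in the cross term of the exponent, where the jitter
    of the last category is minus the sum of the others. *)
Definition tilt (k : d.-tuple nat) (j : 'I_d) : R :=
  ((all_counts n k (lift ord_max j))%:R - m (lift ord_max j)) / m (lift ord_max j)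
  - ((all_counts n k ord_max)%:R - m ord_max) / m ord_max.

Lemma multinomial_pmf_gt0 (k : d.-tuple nat) : (\sum_j tnth k j <= n)%N ->
  0 < multinomial_pmf n p k.
Proof.
move=> kn; rewrite /multinomial_pmf kn mulr_gt0//.
  by rewrite divr_gt0 ?ltr0n ?fact_gt0// prodr_gt0// => i _; rewrite ltr0n fact_gt0.
by rewrite prodr_gt0// => i _; rewrite exprn_gt0// all_probs_gt0.
Qed.

(** The squared deviations of the counts cancel between [ln_multinomial_pmf_le] and the
    normal exponent.  Of the square of a count deviation plus a jitter, the cross term
    and the squared jitter remain; the latter is estimated by [sqr_sum_le]. *)
Lemma log_ratio_le (t : R) (k : d.-tuple nat) (u : Rn R d) :
  (forall i, (m i)^-1 <= t) -> (\sum_j tnth k j <= n)%N ->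
  ln (multinomial_pmf n p k) - ln (Q (jitter (k, u))) <=
  affine_sqr (\sum_i stirling_excess (all_counts n k i) (m i))
    (t / 2 * (d.+1%:R * d%:R)) (tilt k) u.
Proof.
move=> ht kn.
have m0 i : 0 < m i by rewrite mulr_gt0 ?ltr0n// all_probs_gt0.
have t0 : 0 <= t by apply: le_trans (ht ord_max); rewrite invr_ge0 ltW.
have h1 := ln_multinomial_pmf_le n0 op kn.
rewrite ln_mvnormal_pdf.
pose D i : R := (all_counts n k i)%:R - m i; pose v := zero_sum_ext (tnth u).
have -> : \sum_i zero_sum_ext (fun j => tnth (jitter (k, u)) j - n%:R * p 0 j) i ^+ 2 / m i
   = \sum_i D i ^+ 2 / m i + 2 * \sum_i D i * v i / m i + \sum_i v i ^+ 2 / m i.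
  rewrite mulr_sumr -!big_split/=; apply: eq_bigr => i _.
  rewrite zero_sum_ext_jitter// -/(D i) -/(v i).
  by have := lt0r_neq0 (m0 i); set M := m i => M0; field.
have lin : \sum_i D i * v i / m i = \sum_j tilt k j * tnth u j.
  under eq_bigr do rewrite mulrAC.
  rewrite (sum_zero_sum_ext _ (fun i z => D i / m i * z)) mulrN mulr_sumr -sumrB.
  by apply: eq_bigr => j _; rewrite /tilt -mulrBl.
have v2 i : v i ^+ 2 <= d%:R * \sum_j tnth u j ^+ 2.
  rewrite /v /zero_sum_ext; case: unliftP => [j _|_]; last by rewrite sqrrN; exact: sqr_sum_le.
  have d1 : 1 <= d%:R :> R by rewrite ler1n; case: (d) j => // -[].
  apply: (@le_trans _ _ (\sum_j tnth u j ^+ 2)).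
    by rewrite (bigD1 j)//= lerDl sumr_ge0// => i' _; rewrite sqr_ge0.
  by rewrite ler_peMl// sumr_ge0// => i' _; rewrite sqr_ge0.
have quad : \sum_i v i ^+ 2 / m i <= t * (d.+1%:R * d%:R) * \sum_j tnth u j ^+ 2.
  apply: (@le_trans _ _ (\sum_(i < d.+1) (d%:R * \sum_j tnth u j ^+ 2) * t)).
    apply: ler_sum => i _; apply: ler_pM => //; first by rewrite sqr_ge0.
    by rewrite invr_ge0 ltW.
  by rewrite sumr_const card_ord -mulr_natl le_eqVlt; apply/orP; left; apply/eqP; ring.
rewrite lin /affine_sqr.
have -> : t / 2 * (d.+1%:R * d%:R) * \sum_j tnth u j ^+ 2 =
  (t * (d.+1%:R * d%:R) * \sum_j tnth u j ^+ 2) / 2 by ring.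
move: h1; rewrite sumrB.
have -> : \sum_i ((all_counts n k i)%:R - m i) ^+ 2 / (2 * m i) = (\sum_i D i ^+ 2 / m i) / 2.
  rewrite mulr_suml; apply: eq_bigr => i _; rewrite /D.
  by have := lt0r_neq0 (m0 i); set M := m i => M0; field.
move: quad; set x1 := ln (multinomial_pmf _ _ _).
set x2 := (_ + \sum_i ln _); set x3 := \sum_i stirling_excess _ _.
set x4 := \sum_i D i ^+ 2 / _; set x5 := \sum_j tilt k j * _; set x6 := \sum_i v i ^+ 2 / _.
set x7 := t * _ * _.
by clearbody x1 x2 x3 x4 x5 x6 x7; lra.
Qed.

End log_ratio.

(** * Comparison of the two laws *)

Section comparison.
Context {R : realType} {d : nat}.
Variables (n : nat) (p : 'rV[R]_d).
Hypotheses (n0 : (0 < n)%N) (op : open_simplex p).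
Local Notation mu := (@lebesgue_measure R).
Local Notation Q := (mvnormal_pdf (n%:R *: p) (n%:R *: multinomial_cov p)).
Local Notation normal := (mvnormal_prob (n%:R *: p) (n%:R *: multinomial_cov p)).
Local Notation P w := (multinomial_pmf n p (counts_of w)).
Local Notation m i := (n%:R * all_probs p i).
Local Notation U := (@uniform_cube R d).

Lemma integrable_mvnormal_jitter (w : d.-tuple 'I_n.+1) :
  U.-integrable setT (fun u => (Q (jitter (counts_of w, u)))%:E).
Proof.
have mQ := measurable_mvnormal_pdf (n%:R *: p) (n%:R *: multinomial_cov p).
have mJ := @measurable_jitter_fixed R d (counts_of w).
apply/integrableP; split; first by apply/measurable_EFinP; exact: (measurableT_comp mQ mJ).
under eq_integral do rewrite gee0_abs ?lee_fin ?mvnormal_pdf_ge0//.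
apply: (@le_lt_trans _ _ 1%E); last by rewrite ltry.
rewrite -(mvnormal_prob_setT n0 op) /mvnormal_prob.
have mQE : measurable_fun [set: Rn R d] (fun x => (Q x)%:E) by exact/measurable_EFinP.
apply: le_trans (sum_uniform_cube_le n mQE _); last by move=> x; rewrite lee_fin mvnormal_pdf_ge0.
rewrite (bigD1 w)//= leeDl//; apply: sume_ge0 => v _; apply: integral_ge0 => x _.
by rewrite lee_fin mvnormal_pdf_ge0.
Qed.

(** [mass_le_density] integrated over the jitter.  The linear part of [log_ratio_le]
    disappears because the jitter has mean 0. *)
Lemma cell_le (t e : R) (w : d.-tuple 'I_n.+1) (A : set (Rn R d)) :
  0 < e -> (forall i, (m i)^-1 <= t) -> measurable A ->
  ((P w)%:E * \int[U]_u (\1_A (jitter (counts_of w, u)))%:E <=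
  \int[U]_u (Q (jitter (counts_of w, u)) * \1_A (jitter (counts_of w, u)))%:E
  + (2 / e)%:E * \int[U]_u (Q (jitter (counts_of w, u)))%:E
  + (P w * (e / 2 + 2 / e *
       (\sum_i stirling_excess (all_counts n (counts_of w) i) (m i)
        + t / 2 * (d.+1%:R * d%:R) * (d%:R / 4) - 1)))%:E)%E.
Proof.
move=> e0 ht mA.
have [kn|kn] := boolP (\sum_j tnth (counts_of w) j <= n)%N; last first.
  rewrite {1 2}/multinomial_pmf ifN// !mul0r mul0e adde0.
  apply: adde_ge0; last first.
    apply: mule_ge0; first by rewrite lee_fin divr_ge0// ltW.
    by apply: integral_ge0 => u _; rewrite lee_fin mvnormal_pdf_ge0.
  by apply: integral_ge0 => u _; rewrite lee_fin mulr_ge0 ?mvnormal_pdf_ge0.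
have P0 := multinomial_pmf_gt0 op kn.
set Pw := P w in P0 *; set k := counts_of w.
have m0 i : 0 < m i by rewrite mulr_gt0 ?ltr0n// all_probs_gt0.
have t0 : 0 <= t by apply: le_trans (ht ord_max); rewrite invr_ge0 ltW.
pose X := \sum_i stirling_excess (all_counts n k i) (m i).
pose a := t / 2 * (d.+1%:R * d%:R).
pose g := 2 / e; have g0 : 0 < g by rewrite divr_gt0.
pose B u := affine_sqr (Pw * (e / 2 + g * (X - 1))) (g * Pw * a)
  (fun j => g * Pw * tilt n p k j) u.
have a0 : 0 <= g * Pw * a.
  apply: mulr_ge0; first exact: (mulr_ge0 (ltW g0) (ltW P0)).
  by apply: mulr_ge0 => //; exact: divr_ge0.
have [iB leB] := integral_affine_sqr (Pw * (e / 2 + g * (X - 1)))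
  (fun j => g * Pw * tilt n p k j) a0.
have mQ := measurable_mvnormal_pdf (n%:R *: p) (n%:R *: multinomial_cov p).
have mJ := @measurable_jitter_fixed R d k.
have m1 : measurable_fun [set: Rn R d] (fun u : Rn R d => \1_A (jitter (k, u)) : R).
  by apply: (measurableT_comp _ mJ); exact: measurable_indic.
have i2 := integrable_mvnormal_jitter w; rewrite -/k in i2.
have i1 : U.-integrable setT (fun u => (Q (jitter (k, u)) * \1_A (jitter (k, u)))%:E).
  apply: (le_integrable _ _ _ i2) => //.
    by apply/measurable_EFinP/measurable_funM => //; exact: (measurableT_comp mQ mJ).
  move=> u _; rewrite lee_fin !ger0_norm ?mulr_ge0 ?mvnormal_pdf_ge0//.
  by rewrite ler_piMr ?mvnormal_pdf_ge0// indicE; case: (_ \in _).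
have i3 : U.-integrable setT (fun u => g%:E * (Q (jitter (k, u)))%:E)%E by exact: integrableZl.
have i4 : U.-integrable setT (fun u => (Q (jitter (k, u)) * \1_A (jitter (k, u)))%:E
    + g%:E * (Q (jitter (k, u)))%:E)%E by exact: integrableD.
have i5 : U.-integrable setT (fun u => (Q (jitter (k, u)) * \1_A (jitter (k, u)))%:E
    + g%:E * (Q (jitter (k, u)))%:E + (B u)%:E)%E by exact: integrableD.
rewrite -ge0_integralZl//; last 2 first.
- exact/measurable_EFinP.
- by rewrite lee_fin ltW.
apply: (@le_trans _ _ (\int[U]_u ((Q (jitter (k, u)) * \1_A (jitter (k, u)))%:E
    + g%:E * (Q (jitter (k, u)))%:E + (B u)%:E))%E); last first.
  rewrite integralD// integralD// integralZl//; apply: leeD => //.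
  apply: (le_trans leB); rewrite lee_fin le_eqVlt; apply/orP; left; apply/eqP.
  by rewrite -/X -/a -/g; ring.
apply: ge0_le_integral => //.
- by move=> u _; rewrite mule_ge0// lee_fin ltW.
- by apply/measurable_funeM/measurable_EFinP.
- exact: measurable_int i5.
- move=> u _; rewrite -!EFinM -!EFinD lee_fin indicE.
have := @mass_le_density R Pw (Q (jitter (k, u))) _ e (jitter (k, u) \in A) P0
  (mvnormal_pdf_gt0 n0 op _) e0 (log_ratio_le n0 op u ht kn).
move=> h; apply: (le_trans h); rewrite -/g lerD2l /B.
rewrite le_eqVlt; apply/orP; left; apply/eqP; rewrite /affine_sqr -/X -/a.
rewrite (_ : \sum_j g * Pw * tilt n p k j * tnth u j =
  g * Pw * \sum_j tilt n p k j * tnth u j); first by ring.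
by rewrite mulr_sumr; apply: eq_bigr => j _; rewrite mulrA.
Qed.

(** The sum of [cell_le] over all cells.  The third hypothesis says that the bound on the
    relative entropy is at most e^2/4. *)
Lemma jittered_le_normal (t e : R) (A : set (Rn R d)) : 0 < e ->
  (forall i, (m i)^-1 <= t) ->
  d.+1%:R * (7 / 6 * t) + t / 2 * (d.+1%:R * d%:R) * (d%:R / 4) <= e ^+ 2 / 4 ->
  measurable A -> (jittered_multinomial n p A <= normal A + e%:E)%E.
Proof.
move=> e0 ht kl mA.
have sp := open_simplexW op.
have mQ := measurable_mvnormal_pdf (n%:R *: p) (n%:R *: multinomial_cov p).
rewrite jittered_multinomialE//.
apply: (le_trans (lee_sum _ (fun w _ => cell_le w e0 ht mA))).
rewrite 2!big_split/=.
set a := t / 2 * _ * _ in kl *; set g := 2 / e.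
have g0 : 0 < g by rewrite divr_gt0.
have s1 : (\sum_(w : d.-tuple 'I_n.+1)
    \int[U]_u (Q (jitter (counts_of w, u)) * \1_A (jitter (counts_of w, u)))%:E
    <= normal A)%E.
  rewrite /mvnormal_prob integral_mkcond.
  have mQA : measurable_fun [set: Rn R d] (fun x => (Q x * \1_A x)%:E).
    by apply/measurable_EFinP/measurable_funM => //; exact: measurable_indic.
  apply: (le_trans (sum_uniform_cube_le n mQA _)).
    by move=> x; rewrite lee_fin mulr_ge0// mvnormal_pdf_ge0.
  rewrite le_eqVlt; apply/orP; left; apply/eqP; apply: eq_integral => x _.
  by rewrite patchE indicE; case: ifP => _; rewrite ?mulr1 ?mulr0.
have s2 : (\sum_(w : d.-tuple 'I_n.+1) \int[U]_u (Q (jitter (counts_of w, u)))%:E <= 1)%E.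
  rewrite -(mvnormal_prob_setT n0 op) /mvnormal_prob.
  apply: sum_uniform_cube_le; first exact/measurable_EFinP.
  by move=> x; rewrite lee_fin mvnormal_pdf_ge0.
rewrite -ge0_sume_distrr; last first.
  by move=> w _; apply: integral_ge0 => u _; rewrite lee_fin mvnormal_pdf_ge0.
rewrite -addeA; apply: leeD => //; rewrite sumEFin.
apply: (@le_trans _ _ (g%:E * 1 + (e / 2 + g * (d.+1%:R * (7 / 6 * t) + a - 1))%:E)%E).
  apply: leeD; first by rewrite lee_wpmul2l// lee_fin ltW.
  rewrite lee_fin.
  have -> : \sum_(w : d.-tuple 'I_n.+1) P w * (e / 2 + g *
       (\sum_i stirling_excess (all_counts n (counts_of w) i) (m i) + a - 1)) =
     (e / 2 + g * (a - 1)) * \sum_(w : d.-tuple 'I_n.+1) P w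
     + g * \sum_i \sum_(w : d.-tuple 'I_n.+1)
         P w * stirling_excess (all_counts n (counts_of w) i) (m i).
    rewrite exchange_big/= !mulr_sumr -big_split/=; apply: eq_bigr => w _.
    by rewrite -mulr_sumr; ring.
  rewrite sum_multinomial_pmf// mulr1.
  have : g * (\sum_i \sum_(w : d.-tuple 'I_n.+1)
         P w * stirling_excess (all_counts n (counts_of w) i) (m i))
     <= g * (d.+1%:R * (7 / 6 * t)).
    rewrite ler_pM2l// mulr_natl -[in leRHS](card_ord d.+1) -sumr_const.
    apply: ler_sum => i _; apply: (le_trans (expected_stirling_excess i n0 op)).
    by rewrite ler_wpM2l.
  set S := \sum_i _; move: (d.+1%:R * _) => z h; nra.
rewrite mule1 -EFinD lee_fin.
have : g * (d.+1%:R * (7 / 6 * t) + a) <= g * (e ^+ 2 / 4) by rewrite ler_pM2l.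
have -> : g * (e ^+ 2 / 4) = e / 2 by rewrite /g; field; rewrite gt_eqF.
by move: (d.+1%:R * _) => z h; nra.
Qed.

End comparison.

(** For laws of equal mass, a one-sided bound on A and on its complement is two-sided. *)
Lemma tv_dist_le disp (T : measurableType disp) (R : realType)
    (mu nu : {measure set T -> \bar R}) (e : R) :
  mu setT = 1%E -> nu setT = 1%E ->
  (forall A, measurable A -> (mu A <= nu A + e%:E)%E) -> (tv_dist mu nu <= e%:E)%E.
Proof.
move=> mu1 nu1 h; apply: ub_ereal_sup => _ [A mA <-].
have C (m : {measure set T -> \bar R}) : m setT = 1%E ->
    exists x, m A = x%:E /\ m (~` A) = (1 - x)%:E.
  move=> m1; have mC := measurableC mA.
  have : (m A + m (~` A) = 1)%E by rewrite -measureU ?setUv// setICr.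
  case: (m A) (m (~` A)) (measure_ge0 m A) (measure_ge0 m (~` A)) => [x| |] [y| |]//= _ _.
  by rewrite -EFinD => -[<-]; exists x; rewrite addrC addKr.
have [x [x1 x2]] := C _ mu1; have [y [y1 y2]] := C _ nu1.
have := h _ mA; have := h _ (measurableC mA); rewrite x1 x2 y1 y2 -!EFinD !lee_fin => h1 h2.
by rewrite ler_norml; apply/andP; split; lra.
Qed.

Theorem proposition2p6 (R : realType) (d : nat) (tau : R) (n : nat)
    (d_gt0 : (0 < d)%N) (tau_ge : d.+1%:R <= tau)
    (n_gt0 : (0 < n)%N) (n_ge : tau ^+ 4 <= n%:R) :
  (ereal_sup [set tv_dist (jittered_multinomial n p)
                          (mvnormal_prob (n%:R *: p) (n%:R *: multinomial_cov p))
             | p in @simplex_le R d tau]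
   <= (803%:R / 100%:R * tau `^ (3 / 2) * d.+1%:R `^ (1 / 2)
       / n%:R `^ (1 / 2))%:E)%E.
Proof.
apply: ub_ereal_sup => _ [p [op hp] <-].
have nR : 0 < n%:R :> R by rewrite ltr0n.
have dR : 1 <= d.+1%:R :> R by rewrite ler1n.
have tau1 : 1 <= tau := le_trans dR tau_ge.
have tau0 : 0 < tau := lt_le_trans ltr01 tau1.
have q8 : 8 <= 803%:R / 100%:R :> R by rewrite ler_pdivlMr// -natrM ler_nat.
(* the constant 8.03 enters only through its lower bound 8 *)
move: (803%:R / 100%:R) q8 => q q8.
set e := _ / _.
have e0 : 0 < e by rewrite divr_gt0 ?mulr_gt0 ?powR_gt0// (lt_le_trans _ q8).
have e2 : e ^+ 2 = q ^+ 2 * (tau ^+ 3 * d.+1%:R / n%:R).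
  have sq (x : R) : 0 <= x -> (x `^ (1 / 2)) ^+ 2 = x.
    by move=> x0; rewrite -powR_mulrn ?powR_ge0// -powRrM mul1r mulVf// powRr1.
  have t32 : (tau `^ (3 / 2)) ^+ 2 = tau ^+ 3.
    by rewrite -powR_mulrn ?powR_ge0// -powRrM divfK// powR_mulrn// ltW.
  have n12 : n%:R `^ (1 / 2) != 0 :> R by rewrite gt_eqF// powR_gt0.
  rewrite -(sq n%:R) ?ltW// -(sq d.+1%:R)// -t32 /e; move: n12.
  by move: (tau `^ _) (d.+1%:R `^ _) (n%:R `^ _) => x y z z0; field.
apply: tv_dist_le; [exact: probability_setT|exact: mvnormal_prob_setT|move=> A mA].
apply: (@jittered_le_normal R d n p n_gt0 op (tau / n%:R)) => //.
  move=> i; rewrite invfM mulrC ler_pM2r ?invr_gt0//.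
  by apply: le_trans hp; exact: (le_bigmax _ (fun i => (all_probs p i)^-1)).
rewrite e2.
have dle : d%:R + 1 <= tau by rewrite natr1.
have d0 : 0 <= d%:R :> R by [].
have -> : d.+1%:R * (7 / 6 * (tau / n%:R))
    + tau / n%:R / 2 * (d.+1%:R * d%:R) * (d%:R / 4) =
  (d.+1%:R * tau / n%:R) * (7 / 6 + d%:R ^+ 2 / 8) by field; rewrite gt_eqF.
have -> : q ^+ 2 * (tau ^+ 3 * d.+1%:R / n%:R) / 4 =
  (d.+1%:R * tau / n%:R) * (q ^+ 2 * tau ^+ 2 / 4) by field; rewrite gt_eqF.
rewrite ler_pM2l ?divr_gt0 ?mulr_gt0//.
have dt : d%:R ^+ 2 + 1 <= tau ^+ 2 by nra.
have : 64 * tau ^+ 2 <= q ^+ 2 * tau ^+ 2 by rewrite ler_wpM2r ?sqr_ge0//; nra.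
move: (q ^+ 2 * tau ^+ 2) (d%:R ^+ 2) (sqr_ge0 (d%:R : R)) (tau ^+ 2) dt.
by move=> x y y0 z yz xz; lra.
Qed.
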